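(* Let $\mathcal{A}$ be a coquasitriangular complex Hopf algebra with universal $r$-form $\mathbf{r}$, let $\mathbf{u}=(u^i_j)_{i,j=1,\dots,n}$ be an $n$-dimensional matrix corepresentation of $\mathcal{A}$ with $L$-functionals $l^{\pm i}_{\ \ j}$ and $R$-matrix $\hat R$. Assume: (a) $l^{+n}_{\ \ m}=l^{-m}_{\ \ n}=0$ for $m<n$, and $S(l^{\pm n}_{\ \ n})=l^{\mp n}_{\ \ n}$; (b) there are non-zero complex numbers $\gamma_1,\dots,\gamma_n$ such that $S^2(u^i_j)=\gamma_i u^i_j\gamma_j^{-1}$ for $i,j=1,\dots,n$; (c) $(l^{+i}_{\ \ n},u^n_j)=0$ for $i\ne j$, $i,j=1,\dots,n$; (d) the number $\beta:=((l^{+n}_{\ \ n})^2,u^n_n)-1$ is non-zero, and $(l^{+n}_{\ \ n}l^{+i}_{\ \ n},u^n_i)=\beta$ for $i=1,\dots,n-1$. Let $\mathcal{Y}$ be the unital subalgebra of $\mathcal{A}$ generated by $y_i:=S(u^n_i)$, $i=1,\dots,n$. Let $\Gamma$ be the left-covariant first order differential calculus (FODC) on $\mathcal{A}$ whose quantum tangent space is the linear span of $$Y_i:=\beta^{-1}S(l^{+i}_{\ \ n})\,l^{-n}_{\ \ n}\ (i=1,\dots,n-1),\qquad Y_n:=\beta^{-1}\big((l^{-n}_{\ \ n})^2-\varepsilon\big).$$ Let $\mathrm{d}$ be the differentiation of $\Gamma$, let $\Gamma^{\mathcal Y}:=\mathcal{Y}\cdot\mathrm{d}\mathcal{Y}\cdot\mathcal{Y}\subseteq\Gamma$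 be the induced FODC on $\mathcal{Y}$, and let $\eta_n:=\omega(S^{-1}(u^n_n))=\sum_j u^j_n\,\mathrm{d}S^{-1}(u^n_j)\in\Gamma$. Then: (i) $\Gamma^{\mathcal Y}$ is a left-covariant FODC on $\mathcal{Y}$ with free left $\mathcal{Y}$-module basis $\{\mathrm{d}y_1,\dots,\mathrm{d}y_n\}$ and with $\mathcal{Y}$-bimodule structure given by the relations $$\mathrm{d}y_i\cdot y_j=(l^{+n}_{\ \ n},u^n_n)\sum_{k,m=1}^n\hat R^{mk}_{ji}\,y_k\cdot\mathrm{d}y_m,\qquad i,j=1,\dots,n,$$ or equivalently by $$\mathrm{d}y_i\cdot y=\sum_{m=1}^n\bar{\mathbf r}(y_{(1)},u^m_i)\,y_{(2)}\,(l^{-n}_{\ \ n},y_{(3)})\,\mathrm{d}y_m,\qquad y\in\mathcal{Y},\ i=1,\dots,n.$$ (ii) For any $y\in\mathcal{Y}$ we have (in $\Gamma$) $\mathrm{d}y=\beta^{-1}(\eta_n y-y\eta_n)$.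
   Context: Hopf algebra notation: $\Delta,\varepsilon,S$ are comultiplication, counit, antipode; Sweedler notation $\Delta(a)=a_{(1)}\otimes a_{(2)}$. $\mathcal{A}^\circ$ is the Hopf dual, with product $(fg)(a)=f(a_{(1)})g(a_{(2)})$, unit $\varepsilon$ and antipode $S(f)(a)=f(S(a))$; $(f,a):=f(a)$ for $f\in\mathcal{A}^\circ$, $a\in\mathcal{A}$. Coquasitriangular: $\mathcal{A}$ is equipped with a convolution-invertible linear functional $\mathbf r$ on $\mathcal{A}\otimes\mathcal{A}$ (universal $r$-form; write $\mathbf r(a,b)=\mathbf r(a\otimes b)$), with convolution inverse $\bar{\mathbf r}$, such that for all $a,b,c\in\mathcal{A}$: $\mathbf r(ab,c)=\mathbf r(a,c_{(1)})\mathbf r(b,c_{(2)})$, $\mathbf r(a,bc)=\mathbf r(a_{(1)},c)\mathbf r(a_{(2)},b)$, $\mathbf r(a_{(1)},b_{(1)})a_{(2)}b_{(2)}=\mathbf r(a_{(2)},b_{(2)})b_{(1)}a_{(1)}$. Matrix corepresentation: $u^i_j\in\mathcal{A}$ with $\Delta(u^i_j)=\sum_k u^i_k\otimes u^k_j$, $\varepsilon(u^i_j)=\delta_{ij}$. $L$-functionals: $l^{+i}_{\ \ j}(a)=\mathbf r(a,u^i_j)$, $l^{-i}_{\ \ j}(a)=\bar{\mathbf r}(u^i_j,a)$; they lie in $\mathcal{A}^\circ$. $R$-matrix: $\hat R^{ji}_{nm}:=\mathbf r(u^i_n,u^j_m)$, so that $(\hat R^{-1})^{ik}_{lj}=\bar{\mathbf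 r}(u^i_j,u^k_l)$. A first order differential calculus (FODC) over an algebra $\mathcal{X}$ is an $\mathcal{X}$-bimodule $\Gamma$ with a linear map $\mathrm{d}:\mathcal{X}\to\Gamma$ such that $\mathrm{d}(xy)=x\cdot\mathrm{d}y+\mathrm{d}x\cdot y$ and $\Gamma$ is the linear span of elements $x\cdot\mathrm{d}y\cdot z$, $x,y,z\in\mathcal X$. If $\mathcal{X}\subseteq\mathcal{A}$ is a subalgebra with $\Delta(\mathcal{X})\subseteq\mathcal{A}\otimes\mathcal{X}$ (e.g. $\mathcal X=\mathcal A$), a FODC $\Gamma$ over $\mathcal{X}$ is left-covariant if there is a linear map $\Phi:\Gamma\to\mathcal{A}\otimes\Gamma$ with $\Phi(x\,\mathrm{d}y)=\Delta(x)(\mathrm{id}\otimes\mathrm{d})\Delta(y)$ for $x,y\in\mathcal{X}$; elements $\eta$ with $\Phi(\eta)=1\otimes\eta$ are left-invariant. For a left-covariant FODC $\Gamma$ over $\mathcal{A}$ put $\omega(a):=S(a_{(1)})\,\mathrm{d}a_{(2)}$ for $a\in\mathcal A$. If the space of left-invariant one-forms is finite-dimensional, the quantum tangent space of $\Gamma$ is the space of linear functionals $X$ on $\mathcal{A}$ with $X(1)=0$ and $X(a)=0$ whenever $\varepsilon(a)=0$ and $\omega(a)=0$. It is a finite-dimensional subspace of $\mathcal{A}^\circ$ and determines $\Gamma$ up to isomorphism. A finite-dimensional subspace $\mathcal{T}\subseteq\mathcal{A}^\circ$ is the quantum tangent space of a left-covariant FODC over $\mathcal{A}$ if and only if $X(1)=0$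 and $\Delta(X)-\varepsilon\otimes X\in\mathcal{T}\otimes\mathcal{A}^\circ$ for all $X\in\mathcal{T}$; under the stated assumptions this holds for the span of $Y_1,\dots,Y_n$.
   Formalization: In (i), the second form of the bimodule relations is false as printed (it contradicts the first for GL_q(2)); it is proved with the extra factor γ_m γ_i^{-1} in the m-th summand. *)

(* Defs.v *)
From HB Require Import structures.
From mathcomp Require Import all_boot all_order all_algebra.
From mathcomp Require Import boolp classical_sets functions.

Set Implicit Arguments.
Unset Strict Implicit.
Unset Printing Implicit Defensive.

Import GRing.Theory.
Local Open Scope quotient_scope.
Local Open Scope classical_set_scope.
Local Open Scope ring_scope.

Reserved Notation "x \ox y" (at level 40, left associativity).

Notation bilinear f := (bilinear_for *:%R *:%R f).

(* Tensors are formal sums of pairs, two sums being identified when no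
   bilinear map separates them; this is the tensor product over K, and [tlift]
   below is its universal property.                                           *)
Section TensorProduct.
Variables (K : fieldType) (V W : lmodType K).
Implicit Types (U : lmodType K) (s t : seq (V * W)).

Definition fsum (U : zmodType) (f : V -> W -> U) s : U :=
  \sum_(p <- s) f p.1 p.2.

Definition tensor_eq s t : bool :=
  `[< forall U (f : V -> W -> U), bilinear f -> fsum f s = fsum f t >].

Fact tensor_eq_refl : reflexive tensor_eq.
Proof. by move=> s; apply/asboolP. Qed.

Fact tensor_eq_sym : symmetric tensor_eq.
Proof. by move=> s t; apply/asboolP/asboolP => h U f hf; rewrite h. Qed.

Fact tensor_eq_trans : transitive tensor_eq.
Proof.
move=> t s r /asboolP h1 /asboolP h2; apply/asboolP => U f hf.
by rewrite h1 // h2.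
Qed.

Canonical tensor_equiv :=
  EquivRel tensor_eq tensor_eq_refl tensor_eq_sym tensor_eq_trans.

Definition tensor : Type := {eq_quot tensor_equiv}.
HB.instance Definition _ := Choice.on tensor.
HB.instance Definition _ := EqQuotient.on tensor.

Definition tclass s : tensor := \pi_({eq_quot tensor_equiv}) s.

Definition tpure (v : V) (w : W) : tensor := tclass [:: (v, w)].

(* Meaningful for bilinear f only: then independent of the representative. *)
Definition tlift (U : zmodType) (f : V -> W -> U) (t : tensor) : U :=
  fsum f (repr t).

Lemma tlift_pi U (f : V -> W -> U) s :
  bilinear f -> tlift f (tclass s) = fsum f s.
Proof.
move=> hf; rewrite /tlift.
have h : tclass (repr (tclass s)) = tclass s by exact: reprK.
by move/eqmodP: h => /asboolP/(_ _ _ hf).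
Qed.

Lemma tensor_ext (x y : tensor) :
  (forall U (f : V -> W -> U), bilinear f -> tlift f x = tlift f y) -> x = y.
Proof.
by move=> h; rewrite -[x]reprK -[y]reprK; apply/eqmodP/asboolP => U f; exact: h.
Qed.

Let tzero : tensor := tclass [::].
Let tadd (x y : tensor) : tensor := tclass (repr x ++ repr y).
Let tscale (k : K) (x : tensor) : tensor :=
  tclass [seq (k *: p.1, p.2) | p <- repr x].
Let topp := tscale (-1).

Lemma fsum_scale U (f : V -> W -> U) k s : bilinear f ->
  fsum f [seq (k *: p.1, p.2) | p <- s] = k *: fsum f s.
Proof.
move=> [hf _]; rewrite /fsum big_map scaler_sumr; apply: eq_bigr => p _ /=.
have h0 : f 0 p.2 = 0.
  by have := hf p.2 (-1) 0 0; rewrite /= scaler0 addr0 scaleN1r addNr.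
by have := hf p.2 k p.1 0; rewrite /= h0 !addr0.
Qed.

Let tlift0 U (f : V -> W -> U) : bilinear f -> tlift f tzero = 0.
Proof. by move=> hf; rewrite tlift_pi // /fsum big_nil. Qed.

Let tliftD U (f : V -> W -> U) x y : bilinear f ->
  tlift f (tadd x y) = tlift f x + tlift f y.
Proof. by move=> hf; rewrite tlift_pi // /fsum big_cat. Qed.

Let tliftZ U (f : V -> W -> U) k x : bilinear f ->
  tlift f (tscale k x) = k *: tlift f x.
Proof. by move=> hf; rewrite tlift_pi // fsum_scale. Qed.

Fact tensor_addA : associative tadd.
Proof. by move=> x y z; apply: tensor_ext => U f hf; rewrite !tliftD // addrA. Qed.

Fact tensor_addC : commutative tadd.
Proof. by move=> x y; apply: tensor_ext => U f hf; rewrite !tliftD // addrC. Qed.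

Fact tensor_add0 : left_id tzero tadd.
Proof.
by move=> x; apply: tensor_ext => U f hf; rewrite tliftD // tlift0 // add0r.
Qed.

Fact tensor_addN : left_inverse tzero topp tadd.
Proof.
move=> x; apply: tensor_ext => U f hf.
by rewrite tliftD // tlift0 // tliftZ // scaleN1r addNr.
Qed.

HB.instance Definition _ :=
  GRing.isZmodule.Build tensor tensor_addA tensor_addC tensor_add0 tensor_addN.

Fact tensor_scaleA a b x : tscale a (tscale b x) = tscale (a * b) x.
Proof. by apply: tensor_ext => U f hf; rewrite !tliftZ // scalerA. Qed.

Fact tensor_scale1 : left_id 1 tscale.
Proof. by move=> x; apply: tensor_ext => U f hf; rewrite tliftZ // scale1r. Qed.

Fact tensor_scaleDr : right_distributive tscale +%R.
Proof.
move=> a x y; apply: tensor_ext => U f hf.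
by rewrite tliftZ // !tliftD // !tliftZ // scalerDr.
Qed.

Fact tensor_scaleDl x : {morph tscale^~ x : a b / a + b}.
Proof.
move=> a b; apply: tensor_ext => U f hf.
by rewrite tliftZ // tliftD // !tliftZ // scalerDl.
Qed.

HB.instance Definition _ := GRing.Zmodule_isLmodule.Build K tensor
  tensor_scaleA tensor_scale1 tensor_scaleDr tensor_scaleDl.

Lemma tlift_linear U (f : V -> W -> U) : bilinear f -> linear (tlift f).
Proof.
move=> hf a x y; rewrite [LHS](tliftD (tscale a x) y hf).
by congr (_ + _); exact: tliftZ.
Qed.

Lemma tlift_pure U (f : V -> W -> U) v w :
  bilinear f -> tlift f (tpure v w) = f v w.
Proof. by move=> hf; rewrite tlift_pi // /fsum big_seq1. Qed.

Lemma tpure_bilinear : bilinear tpure.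
Proof.
by split=> [w|v] a x y; apply: tensor_ext => U f hf;
  rewrite tlift_linear // !tlift_pure //; case: hf => h1 h2; rewrite ?h1 ?h2.
Qed.

End TensorProduct.

Notation "V \ox W" := (tensor V%type W%type) : type_scope.
Notation "v \ox w" := (tpure v w) : ring_scope.

Section TensorOperations.
Variable K : fieldType.

Definition tmap (V V' W W' : lmodType K) (f : V -> V') (g : W -> W') :
    V \ox W -> V' \ox W' :=
  tlift (fun v w => f v \ox g w).

Definition tassoc (U V W : lmodType K) : (U \ox V) \ox W -> U \ox (V \ox W) :=
  tlift (fun t w => tlift (fun u v => u \ox (v \ox w)) t).

Definition tmul (A B : algType K) (s t : A \ox B) : A \ox B :=
  tlift (fun a b => tlift (fun c d => (a * c) \ox (b * d)) t) s.

Definition tensor_of_sets (V W : lmodType K) (P : set V) (Q : set W) :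
    set (V \ox W) :=
  [set t | exists2 s : seq (V * W),
     forall p, p \in s -> P p.1 /\ Q p.2 & t = \sum_(p <- s) p.1 \ox p.2].

Definition lspan (V : lmodType K) (S : set V) : set V :=
  [set v | exists2 s : seq (K * V),
     forall p, p \in s -> S p.2 & v = \sum_(p <- s) p.1 *: p.2].

Definition finite_dim (V : lmodType K) (S : set V) : Prop :=
  exists s : seq V, S `<=` lspan [set` s].

End TensorOperations.

HB.mixin Record isHopfAlgebra (K : fieldType) A of GRing.Algebra K A := {
  comul : A -> A \ox A;
  counit : A -> K;
  antipode : A -> A;
  comul_linear : linear comul;
  comulA : forall a, tassoc (tmap comul id (comul a)) = tmap id comul (comul a);
  comul1 : comul 1 = 1 \ox 1;
  comulM : forall a b, comul (a * b) = tmul (comul a) (comul b);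
  counit_linear : linear_for *%R counit;
  counit_l : forall a, tlift (fun a1 a2 => counit a1 *: a2) (comul a) = a;
  counit_r : forall a, tlift (fun a1 a2 => counit a2 *: a1) (comul a) = a;
  counit1 : counit 1 = 1;
  counitM : forall a b, counit (a * b) = counit a * counit b;
  antipode_linear : linear antipode;
  antipode_l : forall a,
    tlift (fun a1 a2 => antipode a1 * a2) (comul a) = (counit a)%:A;
  antipode_r : forall a,
    tlift (fun a1 a2 => a1 * antipode a2) (comul a) = (counit a)%:A
}.

#[short(type="hopfAlgType")]
HB.structure Definition HopfAlgebra (K : fieldType) :=
  {A of GRing.Algebra K A & isHopfAlgebra K A}.

Section HopfTheory.
Variables (K : fieldType) (A : hopfAlgType K).
Implicit Types (a b c : A) (f g : A -> K).

(* Sweedler notation: for F bilinear, [sw F a] is F(a_(1), a_(2)). *)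
Definition sw (U : zmodType) (F : A -> A -> U) a : U := tlift F (comul a).

(* The inverse function of the antipode, wherever the antipode is bijective;
   that is the case whenever A is coquasitriangular.                          *)
Definition antipode_inv a : A := xget 0 [set b | antipode b = a].

Definition conv f g a : K := sw (fun a1 a2 => f a1 * g a2) a.
Definition fantipode f a : K := f (antipode a).

Record universal_rform (r rbar : {scalar (A \ox A)%type}) : Prop := {
  rformV : forall a b,
    sw (fun a1 a2 => sw (fun b1 b2 => r (a1 \ox b1) * rbar (a2 \ox b2)) b) a
      = counit a * counit b;
  rformVl : forall a b,
    sw (fun a1 a2 => sw (fun b1 b2 => rbar (a1 \ox b1) * r (a2 \ox b2)) b) a
      = counit a * counit b;
  rform_mull : forall a b c,
    r ((a * b) \ox c) = sw (fun c1 c2 => r (a \ox c1) * r (b \ox c2)) c;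
  rform_mulr : forall a b c,
    r (a \ox (b * c)) = sw (fun a1 a2 => r (a1 \ox c) * r (a2 \ox b)) a;
  rform_comm : forall a b,
    sw (fun a1 a2 => sw (fun b1 b2 => r (a1 \ox b1) *: (a2 * b2)) b) a
      = sw (fun a1 a2 => sw (fun b1 b2 => r (a2 \ox b2) *: (b1 * a1)) b) a
}.

Definition matrix_corep n (u : 'M[A]_n) : Prop :=
  forall i j, comul (u i j) = \sum_k u i k \ox u k j
              /\ counit (u i j) = (i == j)%:R.

Definition gen_subalg (S : set A) : set A :=
  [set a | forall X : set A, GRing.subalg_closed [in X] -> S `<=` X -> X a].

End HopfTheory.

Section LFunctionals.
Variables (K : fieldType) (A : hopfAlgType K) (r rbar : {scalar (A \ox A)%type}).
Variables (n : nat) (u : 'M[A]_n).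

(* [lplus i j] is l^{+i}_j, [lminus i j] is l^{-i}_j, and [Rhat j i k m] is
   \hat R^{ji}_{km}: upper indices come first.                                *)
Definition lplus (i j : 'I_n) (a : A) : K := r (a \ox u i j).
Definition lminus (i j : 'I_n) (a : A) : K := rbar (u i j \ox a).
Definition Rhat (j i k m : 'I_n) : K := r (u i k \ox u j m).

End LFunctionals.

(* The operations of a calculus over A. Calculi over a subalgebra X of A are
   described by a subspace G of [forms], with the same operations restricted
   to X and G.                                                                *)
Record calculus_ops (K : fieldType) (A : algType K) := CalculusOps {
  forms :> lmodType K;
  lact : A -> forms -> forms;
  ract : forms -> A -> forms;
  diff : A -> forms
}.

Section Calculi.
Variables (K : fieldType) (A : hopfAlgType K) (Gam : calculus_ops A).
Implicit Types (X : set A) (G : set Gam) (Phi : Gam -> A \ox Gam).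

Local Notation "x *L g" := (lact (c := Gam) x g) (at level 40).
Local Notation "g *R x" := (ract (c := Gam) g x) (at level 40).
Local Notation d := (@diff K A Gam).

Record bimodule_on X G : Prop := {
  bimod_submod : GRing.submod_closed [in G];
  bimod_lact : forall x g, X x -> G g -> G (x *L g);
  bimod_ract : forall x g, X x -> G g -> G (g *R x);
  bimod_lactDl : forall k x y g, X x -> X y -> G g ->
    (k *: x + y) *L g = k *: (x *L g) + y *L g;
  bimod_lactDr : forall k x g h, X x -> G g -> G h ->
    x *L (k *: g + h) = k *: (x *L g) + x *L h;
  bimod_ractDr : forall k x y g, X x -> X y -> G g ->
    g *R (k *: x + y) = k *: (g *R x) + g *R y;
  bimod_ractDl : forall k x g h, X x -> G g -> G h ->
    (k *: g + h) *R x = k *: (g *R x) + h *R x;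
  bimod_lact1 : forall g, G g -> 1 *L g = g;
  bimod_ract1 : forall g, G g -> g *R 1 = g;
  bimod_lactM : forall x y g, X x -> X y -> G g -> (x * y) *L g = x *L (y *L g);
  bimod_ractM : forall x y g, X x -> X y -> G g -> g *R (x * y) = (g *R x) *R y;
  bimod_assoc : forall x y g, X x -> X y -> G g ->
    (x *L g) *R y = x *L (g *R y)
}.

Definition XdXX X : set Gam :=
  lspan [set g | exists x y z, [/\ X x, X y, X z & g = (x *L d y) *R z]].

Record fodc_on X G : Prop := {
  fodc_subalg : GRing.subalg_closed [in X];
  fodc_bimod : bimodule_on X G;
  fodc_diff : forall x, X x -> G (d x);
  fodc_linear : forall k x y, X x -> X y -> d (k *: x + y) = k *: d x + d y;
  fodc_leibniz : forall x y, X x -> X y -> d (x * y) = x *L d y + d x *R y;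
  fodc_span : G = XdXX X
}.

(* The last clause is Phi (x dy) = Delta(x) (id \ox d) Delta(y), the two
   comultiplications being written as arbitrary elements of A \ox X, since d
   and the action of X on G are only relevant on X.                           *)
Record left_coaction_on X G Phi : Prop := {
  coact_comul : forall x, X x -> tensor_of_sets setT X (comul x);
  coact_in : forall g, G g -> tensor_of_sets setT G (Phi g);
  coact_linear : forall k g h, G g -> G h ->
    Phi (k *: g + h) = k *: Phi g + Phi h;
  coact_diff : forall x y (s t : seq (A * A)), X x -> X y ->
    (forall p, p \in s -> X p.2) -> comul x = \sum_(p <- s) p.1 \ox p.2 ->
    (forall p, p \in t -> X p.2) -> comul y = \sum_(p <- t) p.1 \ox p.2 ->
    Phi (x *L d y) =
      \sum_(p <- s) \sum_(q <- t) (p.1 * q.1) \ox (p.2 *L d q.2)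
}.

Definition left_covariant_fodc_on X G : Prop :=
  fodc_on X G /\ exists Phi, left_coaction_on X G Phi.

Definition left_basis X G n (b : 'I_n -> Gam) : Prop :=
  [/\ forall i, G (b i),
      forall g, G g -> exists2 c : 'I_n -> A,
        (forall i, X (c i)) & g = \sum_i c i *L b i
    & forall c : 'I_n -> A, (forall i, X (c i)) ->
        \sum_i c i *L b i = 0 -> forall i, c i = 0].

Definition omega (a : A) : Gam := sw (fun a1 a2 => antipode a1 *L d a2) a.

(* Gam is taken here as a left-covariant calculus over all of A. *)
Definition left_invariant Phi : set Gam := [set g | Phi g = 1 \ox g].

Definition quantum_tangent_space : set (A -> K^o) :=
  [set X | [/\ linear X, X 1 = 0
             & forall a, counit a = 0 -> omega a = 0 -> X a = 0]].

Definition has_quantum_tangent_space (T : set (A -> K^o)) : Prop :=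
  (exists2 Phi, left_coaction_on setT setT Phi
              & finite_dim (left_invariant Phi))
  /\ quantum_tangent_space = T.

End Calculi.

Section TangentFunctionals.
Variables (K : fieldType) (A : hopfAlgType K) (r rbar : {scalar (A \ox A)%type}).
Variables (n : nat) (u : 'M[A]_n.+1).

Let lp := lplus r u.
Let lm := lminus rbar u.
Let N : 'I_n.+1 := ord_max.

Definition beta : K := conv (lp N N) (lp N N) (u N N) - 1.

Definition Yfun (i : 'I_n.+1) : A -> K^o := fun a =>
  if i == N then beta^-1 * (conv (lm N N) (lm N N) a - counit a)
  else beta^-1 * conv (fantipode (lp i N)) (lm N N) a.

End TangentFunctionals.

(* Main.v *)
Require Import Defs.
From mathcomp Require Import all_boot all_order all_algebra.
From mathcomp Require Import boolp classical_sets functions reals.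
From mathcomp Require Import complex.

Import GRing.Theory.
Local Open Scope classical_set_scope.
Local Open Scope complex_scope.
Local Open Scope ring_scope.

Set Implicit Arguments.
Unset Strict Implicit.
Unset Printing Implicit Defensive.

(* Put L^j_k := S(l^{+j}_k) l^{-n}_n, so that beta Y_j = L^j_n - delta_jn eps,
   and let w_j be the left-invariant forms with omega(a) = sum_j Y_j(a) w_j.
   From L^j_n(ab) = sum_k L^k_n(a) L^j_k(b) one reads off the commutation rules
   w_i c = sum_j c_(1) L^j_i(c_(2)) w_j; for i = n they say that
   w_n c - c w_n = beta dc, and w_n = eta_n.

   The hypotheses give Y_i(y_j) = delta_ij gamma_n / gamma_i, hence
   dy_i = sum_k (gamma_n / gamma_k) S(u^k_i) w_k. As S^2(u) is conjugate to u,
   the matrix S(u) is invertible over A, so the dy_i are free over A, and the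
   rules for the w_i turn into those for the dy_i once c_(1) is moved across
   u^m_j by means of the r-form. By these rules, the left Y-span of the dy_i is
   stable under right multiplication by Y, so it is all of Y dY Y. *)

(** The w_j are not given: the hypothesis on the tangent space only provides functionals, and the
    w_j have to be built from the coordinates of omega. Whether they are independent is decided by
    pairing with the y_j. Hypotheses (c) and (d) are exactly what makes the matrix Y_i(y_j)
    diagonal: the relevant convolution values are beta for i different from n and beta + 1 for i =
    n, where the subtracted eps removes the 1. This explains the common factor beta^{-1}. The
    scalars gamma_m / gamma_i in the second form of the relations encode S^2, as (gamma_m / gamma_i)
    u^m_i = S^2(u^m_i). Stability of the span of the dy_i under Y is read off from the R-matrix
    form. The general formula has y_(2), the middle leg of a threefold coproduct, as coefficient,
    and Delta(Y) inside A ⊗ Y does not place that leg in Y. Finally, [antipode_inv] is only a chosen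
    preimage. Computing S^{-1}(u^n_j) requires S to be injective, which is derived from the
    r-form. *)

Local Notation bilinear f := (bilinear_for *:%R *:%R f).

(** * Linearity and Sweedler notation *)

Section Linearity.
Variable K : fieldType.
Implicit Types (U V W X : lmodType K) (B : algType K).

Lemma linear_zero V W (f : V -> W) : linear f -> f 0 = 0.
Proof. by move=> hf; rewrite -[0](subrr 0) (zmod_morphism_linear hf) subrr. Qed.

Lemma linear_add V W (f : V -> W) x y : linear f -> f (x + y) = f x + f y.
Proof. by move=> hf; rewrite -[x]scale1r hf !scale1r. Qed.

Lemma linear_sub V W (f : V -> W) x y : linear f -> f (x - y) = f x - f y.
Proof. by move=> hf; rewrite (zmod_morphism_linear hf). Qed.

Lemma linear_scale V W (f : V -> W) k x : linear f -> f (k *: x) = k *: f x.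
Proof. by move=> hf; rewrite (scalable_linear hf). Qed.

Lemma linear_bigsum V W (f : V -> W) (I : Type) (s : seq I) (P : pred I) F :
  linear f -> f (\sum_(i <- s | P i) F i) = \sum_(i <- s | P i) f (F i).
Proof.
move=> hf; apply: (big_morph f _ (linear_zero hf)) => x y.
exact: linear_add.
Qed.

Lemma lin_id V : linear (fun x : V => x). Proof. by []. Qed.

Lemma lin_comp U V W (g : V -> W) (f : U -> V) :
  linear g -> linear f -> linear (fun x => g (f x)).
Proof. by move=> hg hf k x y; rewrite hf hg. Qed.

Lemma lin_mull V B (f : V -> B) c : linear f -> linear (fun x => f x * c).
Proof. by move=> hf k x y; rewrite hf mulrDl scalerAl. Qed.

Lemma lin_mulr V B (f : V -> B) c : linear f -> linear (fun x => c * f x).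
Proof. by move=> hf k x y; rewrite hf mulrDr scalerAr. Qed.

Lemma lin_kmull V (f : V -> K^o) (c : K) :
  linear f -> linear ((fun x => (f x : K) * c) : V -> K^o).
Proof. by move=> hf k x y; rewrite hf [LHS]mulrDl -[X in X + _ = _]mulrA. Qed.

Lemma lin_kmulr V (f : V -> K^o) (c : K) :
  linear f -> linear ((fun x => c * (f x : K)) : V -> K^o).
Proof. by move=> hf k x y; rewrite hf [LHS]mulrDr [X in X + _ = _]mulrCA. Qed.

Lemma lin_scale V W (f : V -> W) (c : K) :
  linear f -> linear (fun x => c *: f x).
Proof. by move=> hf k x y; rewrite hf scalerDr !scalerA mulrC. Qed.

Lemma lin_scalel V W (f : V -> K^o) (w : W) :
  linear f -> linear (fun x => (f x : K) *: w).
Proof. by move=> hf k x y; rewrite hf scalerDl scalerA. Qed.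

Lemma lin_sum V W (I : Type) (s : seq I) (P : pred I) (f : I -> V -> W) :
  (forall i, linear (f i)) -> linear (fun x => \sum_(i <- s | P i) f i x).
Proof.
move=> hf k x y; rewrite scaler_sumr -big_split; apply: eq_bigr => i _.
exact: hf.
Qed.

(** For a fixed tensor, [tlift] is a finite sum over its representative, so linearity in an outside
    parameter passes through termwise. The same remark gives [tlift_lin], [sw_exch] and [sw_sum]. *)
Lemma lin_tlift_in U V W X (F : U -> V -> W -> X) c :
  (forall a b, linear (fun x => F x a b)) -> linear (fun x => tlift (F x) c).
Proof. by move=> hF; apply: lin_sum => p. Qed.

Lemma lin_tlift U V W X (F : V -> W -> X) (f : U -> V \ox W) :
  bilinear F -> linear f -> linear (fun x => tlift F (f x)).
Proof. by move=> hF; apply: (lin_comp (tlift_linear hF)). Qed.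

Lemma lin_tpurel U V W (f : U -> V) (w : W) :
  linear f -> linear (fun x => f x \ox w).
Proof. exact: (lin_comp ((@tpure_bilinear K V W).1 w)). Qed.

Lemma lin_tpurer U V W (f : U -> W) (v : V) :
  linear f -> linear (fun x => v \ox f x).
Proof. exact: (lin_comp ((@tpure_bilinear K V W).2 v)). Qed.

Lemma lin_scalar V W (h : {scalar W}) (f : V -> W) :
  linear f -> linear ((fun x => h (f x)) : V -> K^o).
Proof. by move=> hf k x y; rewrite hf linearP. Qed.

Lemma tlift_lin V W U X (g : U -> X) (F : V -> W -> U) t :
  linear g -> g (tlift F t) = tlift (fun x y => g (F x y)) t.
Proof. exact: linear_bigsum. Qed.

End Linearity.

Section HopfLinearity.
Variables (K : fieldType) (A : hopfAlgType K).
Implicit Types (U V W : lmodType K).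

Lemma lin_antipode V (f : V -> A) :
  linear f -> linear (fun x => antipode (f x)).
Proof. by apply: (lin_comp (@antipode_linear K A)). Qed.

Lemma lin_comul V (f : V -> A) : linear f -> linear (fun x => comul (f x)).
Proof. by apply: (lin_comp (@comul_linear K A)). Qed.

Lemma lin_counit V (f : V -> A) :
  linear f -> linear ((fun x => counit (f x)) : V -> K^o).
Proof. by move=> hf k x y; rewrite hf counit_linear. Qed.

Lemma lin_sw_in V W (F : V -> A -> A -> W) c :
  (forall a b, linear (fun x => F x a b)) -> linear (fun x => sw (F x) c).
Proof. exact: lin_tlift_in. Qed.

Lemma lin_sw V W (F : A -> A -> W) (f : V -> A) :
  bilinear F -> linear f -> linear (fun x => sw F (f x)).
Proof.
by move=> hF hf; apply: (@lin_tlift K _ A A) => //; apply: lin_comul.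
Qed.

End HopfLinearity.

(** The case of [lin] for maps whose linearity is in the context, possibly after fixing up to three
    parameters. *)
Ltac lin_hyp tac :=
  match goal with
  | H : bilinear_for _ _ _ |- _ => first
      [ exact (fst H _) | exact (snd H _)
      | refine (lin_comp (fst H _) _); tac | refine (lin_comp (snd H _) _); tac ]
  | H : context [@GRing.linear_for] |- _ => first
      [ exact H | exact (H _) | exact (H _ _) | exact (H _ _ _)
      | refine (lin_comp H _); tac | refine (lin_comp (H _) _); tac
      | refine (lin_comp (H _ _) _); tac | refine (lin_comp (H _ _ _) _); tac]
  end.

(* Linearity of [fun x => E], where [x] occurs exactly once in [E]. *)
Ltac lin := cbv beta; first
  [ apply: lin_id
  | match goal with |- bilinear_for _ _ _ => split end; intros; lin
  | match goal with |- forall _, _ => intros end; lin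
  | apply: lin_antipode; lin
  | apply: lin_counit; lin
  | apply: lin_scalar; lin
  | apply: lin_tpurel; lin
  | apply: lin_tpurer; lin
  | apply: lin_comul; lin
  | apply: lin_sw_in; intros; lin
  | apply: lin_sw; lin
  | apply: lin_tlift_in; intros; lin
  | apply: lin_tlift; lin
  | apply: lin_mull; lin
  | apply: lin_mulr; lin
  | apply: lin_scalel; lin
  | apply: lin_scale; lin
  | apply: lin_kmull; lin
  | apply: lin_kmulr; lin
  | apply: lin_sum; intros; lin
  | lin_hyp lin ].

Section Sweedler.
Variables (K : fieldType) (A : hopfAlgType K).
Implicit Types (U V W : lmodType K) (a b c : A).

Lemma eq_sw (U : zmodType) (F G : A -> A -> U) a :
  (forall x y, F x y = G x y) -> sw F a = sw G a.
Proof. by move=> e; apply: eq_bigr => p _. Qed.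

Lemma sw_lin U W (g : U -> W) (F : A -> A -> U) a :
  linear g -> g (sw F a) = sw (fun x y => g (F x y)) a.
Proof. exact: tlift_lin. Qed.

Lemma sw_exch U (F : A -> A -> A -> A -> U) a b :
  sw (fun x y => sw (fun z w => F x y z w) b) a =
  sw (fun z w => sw (fun x y => F x y z w) a) b.
Proof. exact: exchange_big. Qed.

Lemma sw_sum U (I : finType) (F : I -> A -> A -> U) a :
  sw (fun x y => \sum_i F i x y) a = \sum_i sw (F i) a.
Proof. exact: exchange_big. Qed.

Lemma sw_counitl U (G : A -> U) a : linear G ->
  sw (fun x y => counit x *: G y) a = G a.
Proof.
move=> hG; rewrite -[in RHS](counit_l a) (tlift_lin _ _ hG).
by apply: eq_sw => x y; rewrite (linear_scale _ _ hG).
Qed.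

Lemma sw_counitr U (G : A -> U) a : linear G ->
  sw (fun x y => counit y *: G x) a = G a.
Proof.
move=> hG; rewrite -[in RHS](counit_r a) (tlift_lin _ _ hG).
by apply: eq_sw => x y; rewrite (linear_scale _ _ hG).
Qed.

Lemma sw_antil U (G : A -> U) a : linear G ->
  sw (fun x y => G (antipode x * y)) a = counit a *: G 1.
Proof.
by move=> hG; rewrite -(linear_scale _ _ hG) -antipode_l (tlift_lin _ _ hG).
Qed.

Lemma sw_antir U (G : A -> U) a : linear G ->
  sw (fun x y => G (x * antipode y)) a = counit a *: G 1.
Proof.
by move=> hG; rewrite -(linear_scale _ _ hG) -antipode_r (tlift_lin _ _ hG).
Qed.

Lemma sw_pure U (F : A -> A -> U) a (s : seq (A * A)) : bilinear F ->
  comul a = \sum_(p <- s) p.1 \ox p.2 -> sw F a = \sum_(p <- s) F p.1 p.2.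
Proof.
move=> hF e; rewrite /sw e (linear_bigsum _ _ _ (tlift_linear hF)).
by apply: eq_bigr => p _; rewrite tlift_pure.
Qed.

Lemma comul_sw a : comul a = sw (fun x y => x \ox y) a.
Proof.
apply: tensor_ext => U f hf; rewrite -/(sw _ _).
rewrite (tlift_lin _ _ (tlift_linear hf)).
by apply: eq_sw => x y; rewrite tlift_pure.
Qed.

Lemma sw_coassoc U (F : A -> A -> A -> U) a :
  (forall y z, linear (fun x => F x y z)) ->
  (forall x z, linear (fun y => F x y z)) ->
  (forall x y, linear (fun z => F x y z)) ->
  sw (fun x z => sw (fun u v => F u v z) x) a =
  sw (fun u x => sw (fun v z => F u v z) x) a.
Proof.
move=> h1 h2 h3.
have := comulA a; rewrite /tassoc /tmap.
have h4 : bilinear (fun (t : A \ox A) (w : A) => tlift (fun u v : A => u \ox (v \ox w)) t) by lin.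
rewrite (tlift_lin _ _ (tlift_linear h4)).
(* [G] induces on A ⊗ (A ⊗ A) the linear map belonging to the trilinear [F]; it is applied to both
   sides of coassociativity. *)
pose G u t := tlift (fun v z => F u v z) t.
have hG : bilinear G by rewrite /G; lin.
move/(congr1 (tlift G)).
rewrite !(tlift_lin _ _ (tlift_linear hG)) => e.

transitivity (tlift (fun x y : A =>
    tlift G (tlift (fun u v : A => u \ox (v \ox y)) (comul x))) (comul a)).
  apply: eq_sw => x z; rewrite (tlift_lin _ _ (tlift_linear hG)).
  by apply: eq_sw => u v; rewrite tlift_pure // /G tlift_pure //; lin.
transitivity (tlift (fun x y : A => tlift G (x \ox comul y)) (comul a)).
  rewrite -e; apply: eq_sw => x z; congr (tlift G _).
  by rewrite tlift_pure.
by apply: eq_sw => x z; rewrite tlift_pure.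
Qed.

Lemma sw_mul U (F : A -> A -> U) a b : bilinear F ->
  sw F (a * b) = sw (fun x y => sw (fun z w => F (x * z) (y * w)) b) a.
Proof.
move=> hF; rewrite /sw comulM /tmul !(tlift_lin _ _ (tlift_linear hF)).
apply: eq_sw => x y; rewrite (tlift_lin _ _ (tlift_linear hF)).
by apply: eq_sw => z w; rewrite tlift_pure.
Qed.

Lemma sw_1 U (F : A -> A -> U) : bilinear F -> sw F 1 = F 1 1.
Proof. by move=> hF; rewrite /sw comul1 tlift_pure. Qed.

Lemma sw_antilC U (F : A -> A -> U) a : bilinear F ->
  sw (fun x w => sw (fun y z => F (antipode x * y) z) w) a = F 1 a.
Proof.
move=> hF; rewrite -(sw_coassoc (F := fun x y z => F (antipode x * y) z)); try lin.
rewrite -[RHS](sw_counitl (G := F 1)); last lin.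
by apply: eq_sw => x z; rewrite (sw_antil (G := F^~ z)) //; lin.
Qed.

Lemma sw_antirC U (F : A -> A -> U) a : bilinear F ->
  sw (fun x w => sw (fun y z => F (x * antipode y) z) w) a = F 1 a.
Proof.
move=> hF; rewrite -(sw_coassoc (F := fun x y z => F (x * antipode y) z)); try lin.
rewrite -[RHS](sw_counitl (G := F 1)); last lin.
by apply: eq_sw => x z; rewrite (sw_antir (G := F^~ z)) //; lin.
Qed.

(** The arguments of [F] are c_(1) S(c_(4)) and c_(2) S(c_(3)): the inner pair cancels first, then
    the outer one. *)
Let sw_antirC2 U (F : A -> A -> U) c : bilinear F ->
  sw (fun t x => sw (fun y z => sw (fun v w =>
    F (v * antipode z) (w * antipode y)) t) x) c = counit c *: F 1 1.
Proof.
move=> hF; under eq_sw => t x do rewrite sw_exch.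
rewrite (sw_coassoc (F := fun v w x => sw (fun y z =>
  F (v * antipode z) (w * antipode y)) x)); try lin.
under eq_sw => v x.
  rewrite (sw_antirC (F := fun p z => F (v * antipode z) p)); last lin.
over.
by rewrite (sw_antir (G := F^~ 1)) //; lin.
Qed.

(** Delta(S(a)) and S(a_(2)) ⊗ S(a_(1)) are a left and a right convolution inverse of Delta. The
    right side is expanded by the first fact and contracted by the second, which is [sw_antirC2]. *)
Lemma sw_antipode U (F : A -> A -> U) a : bilinear F ->
  sw F (antipode a) = sw (fun x y => F (antipode y) (antipode x)) a.
Proof.
move=> hF.
rewrite -[RHS](sw_counitl (G := sw _)); last lin.
under [RHS]eq_sw => z x.
  rewrite (sw_lin (g := fun w => counit z *: w)); last lin.
  under eq_sw => b c.
    (* Inserts 1 ⊗ 1 = Delta(1), then replaces eps(z) Delta(1) by Delta(S(z_(1)) z_(2)). *)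
    rewrite -[antipode c]mul1r -[antipode b]mul1r.
    rewrite -(sw_1 (F := fun p q => F (p * antipode c) (q * antipode b))); last lin.
    rewrite -(sw_antil (G := sw (fun p q => F (p * antipode c) (q * antipode b)))); last lin.
  over.
  rewrite sw_exch.
over.
rewrite (sw_coassoc (F := fun s t x => sw (fun b c =>
  sw (fun p q => F (p * antipode c) (q * antipode b)) (antipode s * t)) x)); try lin.
rewrite -[LHS](sw_counitr (G := fun b => sw F (antipode b))); last lin.
apply: eq_sw => s z; rewrite (sw_lin (g := fun w => counit z *: w)); last lin.
under [RHS]eq_sw => t x.
  under eq_sw => b c.
    rewrite sw_mul; last lin.
  over.
  rewrite sw_exch.
over.
rewrite sw_exch; apply: eq_sw => p q.
rewrite -[in LHS](mulr1 p) -[in LHS](mulr1 q).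
rewrite -(sw_antirC2 (F := fun v w => F (p * v) (q * w))); last lin.
by apply: eq_sw => t x; apply: eq_sw => y w; apply: eq_sw => c d; rewrite !mulrA.
Qed.

Lemma antipode1 : antipode 1 = 1 :> A.
Proof.
have := antipode_l (1 : A); rewrite -/(sw _ _) sw_1; last lin.
by rewrite mulr1 counit1 scale1r.
Qed.

Lemma counit_antipode a : counit (antipode a) = counit a.
Proof.
have lc : linear (counit : A -> K^o) by exact: (lin_counit (f := id) (lin_id (V := A))).
have := congr1 counit (antipode_l a).
rewrite -/(sw _ _) (sw_lin (g := (counit : A -> K^o))) //.
rewrite [RHS](linear_scale (f := (counit : A -> K^o))) // counit1 [RHS]mulr1 => <-.
under eq_sw => x y do rewrite counitM mulrC.
by rewrite (sw_counitr (G := fun x => (counit (antipode x) : K^o))) //; lin.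
Qed.

(** * Convolution inverses of bilinear maps *)

Section Convolution.
Variable B : algType K.
Implicit Types f g h : A -> A -> B.

(** The product of Hom(A ⊗ A, B) in curried form. [B] is [K^o] for the r-forms and [A] for
    identities involving products in A. *)
Definition conv2 f g a b : B :=
  sw (fun x y => sw (fun z w => f x z * g y w) b) a.

Lemma conv2A f g h : bilinear f -> bilinear g -> bilinear h ->
  conv2 (conv2 f g) h = conv2 f (conv2 g h).
Proof.
move=> hf hg hh; apply/funext => a; apply/funext => b; rewrite /conv2.
transitivity (sw (fun x a3 => sw (fun a1 a2 => sw (fun y b3 => sw (fun b1 b2 =>
  f a1 b1 * (g a2 b2 * h a3 b3)) y) b) x) a).
  apply: eq_sw => x a3; rewrite sw_exch; apply: eq_sw => y b3.
  rewrite (sw_lin (g := fun p => p * h a3 b3)); last lin.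
  apply: eq_sw => a1 a2; rewrite (sw_lin (g := fun p => p * h a3 b3)); last lin.
  by apply: eq_sw => b1 b2; rewrite mulrA.
rewrite (sw_coassoc (F := fun a1 a2 a3 => sw (fun y b3 => sw (fun b1 b2 =>
  f a1 b1 * (g a2 b2 * h a3 b3)) y) b)); try lin.
apply: eq_sw => a1 x.
transitivity (sw (fun a2 a3 => sw (fun b1 y => sw (fun b2 b3 =>
  f a1 b1 * (g a2 b2 * h a3 b3)) y) b) x).
  apply: eq_sw => a2 a3.
  by rewrite (sw_coassoc (F := fun b1 b2 b3 => f a1 b1 * (g a2 b2 * h a3 b3))) //; lin.
rewrite sw_exch; apply: eq_sw => b1 y.
rewrite (sw_lin (g := fun p => f a1 b1 * p)); last lin.
apply: eq_sw => a2 a3.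
by rewrite (sw_lin (g := fun p => f a1 b1 * p)) //; lin.
Qed.

Definition conv2_unit a b : B := (counit a * counit b)%:A.

Lemma conv2_1l f : bilinear f -> conv2 conv2_unit f = f.
Proof.
move=> hf; apply/funext => a; apply/funext => b.
rewrite -[RHS](sw_counitl (G := f^~ b)); last lin.
apply: eq_sw => x y; rewrite -[in RHS](sw_counitl (G := f y)); last lin.
rewrite [RHS](sw_lin (g := fun p => counit x *: p)); last lin.
by apply: eq_sw => z w; rewrite /conv2_unit -scalerAl mul1r scalerA.
Qed.

Lemma conv2_1r f : bilinear f -> conv2 f conv2_unit = f.
Proof.
move=> hf; apply/funext => a; apply/funext => b.
rewrite -[RHS](sw_counitr (G := f^~ b)); last lin.
apply: eq_sw => x y; rewrite -[in RHS](sw_counitr (G := f x)); last lin.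
rewrite [RHS](sw_lin (g := fun p => counit y *: p)); last lin.
by apply: eq_sw => z w; rewrite /conv2_unit -scalerAr mulr1 scalerA.
Qed.

(** The usual f = f (g h) = (f g) h = h; it yields [antipodeM], [rform_antipodel] and
    [rbar_antipoder]. *)
Lemma conv2_inv_uniq f g h : bilinear f -> bilinear g -> bilinear h ->
  conv2 f g =2 conv2_unit -> conv2 g h =2 conv2_unit -> f =2 h.
Proof.
move=> hf hg hh e1 e2 a b.
have {}e1 : conv2 f g = conv2_unit.
  by apply/funext => x; apply/funext => y; apply: e1.
have {}e2 : conv2 g h = conv2_unit.
  by apply/funext => x; apply/funext => y; apply: e2.
by rewrite -(conv2_1r hf) -e2 -conv2A // e1 conv2_1l.
Qed.

End Convolution.

(** S(ab) is a left and S(b) S(a) a right convolution inverse of the product map. *)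
Lemma antipodeM a b : antipode (a * b) = antipode b * antipode a.
Proof.
apply: (conv2_inv_uniq (f := fun a b => antipode (a * b)) (g := fun a b => a * b)
  (h := fun a b => antipode b * antipode a)); try lin; move=> {}a {}b.
  rewrite /conv2 -(sw_mul (F := fun x y => antipode x * y)); last lin.
  by rewrite (sw_antil (G := id)) ?counitM //; lin.
rewrite /conv2; under eq_sw => x y.
  under eq_sw => z w do rewrite mulrA -[_ * z * _]mulrA.
  rewrite (sw_antir (G := fun p => x * p * antipode y)); last lin.
  rewrite mulr1.
over.
rewrite -(sw_lin (g := fun p => counit b *: p) (fun x y => x * antipode y)); last lin.
by rewrite (sw_antir (G := id)) ?scalerA 1?mulrC //; lin.
Qed.

End Sweedler.

(** * Universal r-forms *)

Section UniversalRForm.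
Variables (K : fieldType) (A : hopfAlgType K) (r rbar : {scalar (A \ox A)%type}).
Hypothesis hr : universal_rform r rbar.
Implicit Types (a b c : A).

(** In the convolution algebra f = f eps = f f g = f g = eps. It is meant for r(1, .) and r(., 1),
    which are idempotent because 1 is. *)
Lemma conv_idem_counit (f g : A -> K^o) : linear f -> linear g ->
  (forall a, sw (fun x y => f x * f y : K^o) a = f a) ->
  (forall a, sw (fun x y => f x * g y : K^o) a = counit a) ->
  forall a, f a = counit a.
Proof.
move=> hf hg e1 e2 a; rewrite -e2.
transitivity (sw (fun x y => counit y *: f x : K^o) a).
  by rewrite (sw_counitr (G := f)).
transitivity (sw (fun x z => sw (fun y w => f x * f y * g w : K^o) z) a).
  apply: eq_sw => x z; rewrite [LHS]mulrC -e2.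
  rewrite (sw_lin (g := fun p : K^o => f x * p : K^o)); last lin.
  by apply: eq_sw => y w; rewrite mulrA.
rewrite -(sw_coassoc (F := fun x y w => f x * f y * g w : K^o)); try lin.
apply: eq_sw => x z; rewrite -[in RHS]e1.
by rewrite (sw_lin (g := fun p : K^o => p * g z : K^o)) //; lin.
Qed.

Lemma rform_1l b : r (1 \ox b) = counit b.
Proof.
apply: (conv_idem_counit (f := fun b => r (1 \ox b)) (g := fun b => rbar (1 \ox b))); try lin.
  by move=> a; rewrite -[in RHS](mulr1 1) (rform_mull hr).
move=> a; rewrite -[RHS]mul1r -(@counit1 K A) -(rformV hr).
by rewrite [RHS](sw_1 (U := K^o)) //; lin.
Qed.

Lemma rform_1r a : r (a \ox 1) = counit a.
Proof.
apply: (conv_idem_counit (f := fun a => r (a \ox 1)) (g := fun a => rbar (a \ox 1))); try lin.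
  by move=> b; rewrite -[in RHS](mulr1 1) (rform_mulr hr).
move=> b; rewrite -[RHS]mulr1 -(@counit1 K A) -(rformV hr).
by apply: eq_sw => x y; rewrite [RHS](sw_1 (U := K^o)) //; lin.
Qed.

(** Multiplicativity in the first argument and S(a_(1)) a_(2) = eps(a) 1 make r(S(a), b) a left
    convolution inverse of r. *)
Lemma rform_antipodel a b : r (antipode a \ox b) = rbar (a \ox b).
Proof.
apply: (conv2_inv_uniq (B := K^o) (f := fun a b => r (antipode a \ox b))
  (g := fun a b => r (a \ox b)) (h := fun a b => rbar (a \ox b))); try lin.
  move=> {}a {}b; rewrite /conv2_unit [RHS]mulr1 -(rform_1l b).
  rewrite -[RHS](sw_antil (U := K^o) (G := fun p => r (p \ox b))); last lin.
  by apply: eq_sw => x y; rewrite (rform_mull hr).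
by move=> {}a {}b; rewrite /conv2_unit [RHS]mulr1 -(rformV hr).
Qed.

Lemma rbar_1r a : rbar (a \ox 1) = counit a.
Proof. by rewrite -rform_antipodel rform_1r counit_antipode. Qed.

Lemma rbar_mulr a b c :
  rbar (a \ox (b * c)) = sw (fun x y => rbar (x \ox b) * rbar (y \ox c)) a.
Proof.
rewrite -rform_antipodel (rform_mulr hr) [LHS](sw_antipode (U := K^o)); last lin.
by apply: eq_sw => x y; rewrite !rform_antipodel mulrC.
Qed.

Lemma rbar_antipoder a b : rbar (a \ox antipode b) = r (a \ox b).
Proof.
apply/esym.
apply: (conv2_inv_uniq (B := K^o) (h := fun a b => rbar (a \ox antipode b))
  (f := fun a b => r (a \ox b)) (g := fun a b => rbar (a \ox b))); try lin.
  by move=> {}a {}b; rewrite /conv2_unit [RHS]mulr1 -(rformV hr).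
move=> {}a {}b; rewrite /conv2_unit [RHS]mulr1 mulrC -(rbar_1r a).
rewrite -[RHS](sw_antir (U := K^o) (G := fun p => rbar (a \ox p))); last lin.
by rewrite /conv2 sw_exch; apply: eq_sw => x y; rewrite rbar_mulr.
Qed.

Lemma rform_antipode a b : r (antipode a \ox antipode b) = r (a \ox b).
Proof. by rewrite rform_antipodel rbar_antipoder. Qed.

Lemma bilinear_conv2 (B : algType K) (f g : A -> A -> B) :
  bilinear f -> bilinear g -> bilinear (conv2 f g).
Proof. by move=> hf hg; rewrite /conv2; lin. Qed.

(** For the product m and the opposite product n, [rform_comm] reads r m = n r under convolution of
    A-valued maps; convolving with rbar on both sides gives rbar n = m rbar. *)
Lemma rbar_comm a b :
  sw (fun x y => sw (fun z w => rbar (x \ox z) *: (w * y)) b) a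
    = sw (fun x y => sw (fun z w => rbar (y \ox w) *: (x * z)) b) a.
Proof.
pose f a b : A := (r (a \ox b))%:A; pose g a b : A := (rbar (a \ox b))%:A.
pose m a b : A := a * b; pose n a b : A := b * a.
have hf : bilinear f by rewrite /f; lin.
have hg : bilinear g by rewrite /g; lin.
have hm : bilinear m by rewrite /m; lin.
have hn : bilinear n by rewrite /n; lin.
have fg : conv2 f g = conv2_unit A.
  apply/funext => a'; apply/funext => b'.
  rewrite /conv2_unit -(rformV hr) (sw_lin (U := K^o) (g := fun p : K^o => (p : K) *: (1 : A))); last lin.
  apply: eq_sw => x y; rewrite (sw_lin (U := K^o) (g := fun p : K^o => (p : K) *: (1 : A))); last lin.
  by apply: eq_sw => z w; rewrite -scalerAl mul1r scalerA.
have gf : conv2 g f = conv2_unit A.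
  apply/funext => a'; apply/funext => b'.
  rewrite /conv2_unit -(rformVl hr) (sw_lin (U := K^o) (g := fun p : K^o => (p : K) *: (1 : A))); last lin.
  apply: eq_sw => x y; rewrite (sw_lin (U := K^o) (g := fun p : K^o => (p : K) *: (1 : A))); last lin.
  by apply: eq_sw => z w; rewrite -scalerAl mul1r scalerA.
have fm : conv2 f m = conv2 n f.
  apply/funext => a'; apply/funext => b'.
  rewrite /conv2; under eq_sw => x y do under eq_sw => z w do rewrite mulr_algl.
  under [RHS]eq_sw => x y do under eq_sw => z w do rewrite mulr_algr.
  exact: (rform_comm hr a' b').
transitivity (conv2 g n a b).
  by apply: eq_sw => x y; apply: eq_sw => z w; rewrite mulr_algl.
transitivity (conv2 m g a b); last first.
  by apply: eq_sw => x y; apply: eq_sw => z w; rewrite mulr_algr.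
have hfg := bilinear_conv2 hf hg; have hng := bilinear_conv2 hn hg.
have hfm := bilinear_conv2 hf hm; have hmg := bilinear_conv2 hm hg.
have hnf := bilinear_conv2 hn hf; have hgn := bilinear_conv2 hg hn.
congr (_ a b); rewrite -[LHS]conv2_1r // -fg -conv2A // (conv2A hg) // -fm.
by rewrite -(conv2A hg) // gf conv2_1l.
Qed.

(* The Drinfeld functional [g] intertwines S^2 and the identity, and it is
   convolution invertible; this makes the antipode injective. *)
Let g c : K := sw (fun x y => rbar (antipode x \ox y)) c.
Let f c : K := sw (fun x y => r (x \ox antipode y)) c.

Let g_lin : linear (g : A -> K^o).
Proof. by rewrite /g; lin. Qed.

(** Written as rbar(S(a_(1)), a_(4)) S(a_(2)) a_(3), the left side has the form to which [rbar_comm]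
    applies, with the antipode of one leg and the other leg as arguments. *)
Let g_unit a :
  g a *: (1 : A) = sw (fun x v => sw (fun t w => g t *: (w * antipode x)) v) a.
Proof.
transitivity (sw (fun x w => sw (fun x1 x2 => sw (fun w1 w2 =>
    rbar (antipode x1 \ox w2) *: (antipode x2 * w1)) w) x) a).
  rewrite (sw_coassoc (F := fun x1 x2 w => sw (fun w1 w2 =>
    rbar (antipode x1 \ox w2) *: (antipode x2 * w1)) w)); try lin.
  rewrite /g (sw_lin (U := K^o) (g := fun p : K^o => (p : K) *: (1 : A))); last lin.
  apply: eq_sw => x v.
  by rewrite (sw_antilC (F := fun p c => rbar (antipode x \ox c) *: p)) //; lin.
transitivity (sw (fun x w => sw (fun x1 x2 => sw (fun w1 w2 =>
    rbar (antipode x2 \ox w1) *: (w2 * antipode x1)) w) x) a).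
  apply: eq_sw => x w; have := rbar_comm (antipode x) w.
  rewrite sw_antipode; last lin; rewrite sw_antipode; last lin.
  by move=> ->.
rewrite (sw_coassoc (F := fun x1 x2 w => sw (fun w1 w2 =>
    rbar (antipode x2 \ox w1) *: (w2 * antipode x1)) w)); try lin.
apply: eq_sw => x v; rewrite -(sw_coassoc (F := fun x2 w1 w2 =>
    rbar (antipode x2 \ox w1) *: (w2 * antipode x))); try lin.
apply: eq_sw => t w.
by rewrite /g [RHS](sw_lin (U := K^o) (g := fun p : K^o => (p : K) *: (w * antipode x))) //; lin.
Qed.

(** Inserting [g_unit] on the left produces S(a_(2)) S^2(a_(1)) = S(S(a_(1)) a_(2)), which
    cancels. *)
Let g_intertwine a :
  sw (fun x y => g y *: antipode (antipode x)) a = sw (fun x y => g x *: y) a.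
Proof.
transitivity (sw (fun x c => sw (fun y v => sw (fun t w =>
    g t *: (w * antipode (antipode x * y))) v) c) a).
  apply: eq_sw => x y; rewrite -[antipode (antipode x)]mul1r scalerAl g_unit.
  rewrite (sw_lin (g := fun p => p * antipode (antipode x))); last lin.
  apply: eq_sw => z v; rewrite (sw_lin (g := fun p => p * antipode (antipode x))); last lin.
  by apply: eq_sw => t w; rewrite antipodeM -scalerAl mulrA.
rewrite -(sw_coassoc (F := fun x y v => sw (fun t w =>
    g t *: (w * antipode (antipode x * y))) v)); try lin.
rewrite -[RHS](sw_counitl (G := fun b => sw (fun t w => g t *: w) b)); last lin.
apply: eq_sw => p v; rewrite sw_exch.
rewrite [RHS](sw_lin (g := fun q => counit p *: q)); last lin.
apply: eq_sw => t w.
rewrite (sw_antil (G := fun q => g t *: (w * antipode q))); last lin.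
by rewrite antipode1 mulr1.
Qed.

(** [g_intertwine] turns the value into r(S^2(a_(2)), a_(3)) r(S^2(a_(1)), S(a_(4))), which is
    r(S^2(a_(1)), a_(2) S(a_(3))) by [rform_mulr]. *)
Let g_inv a : sw (fun x y => g x * f y) a = counit a.
Proof.
transitivity (sw (fun x q => sw (fun y z => (g y * r (z \ox antipode q) : K^o)) x) a).
  rewrite (sw_coassoc (F := fun y z q => g y * r (z \ox antipode q) : K^o)); try lin.
  by apply: eq_sw => x y; rewrite /f (sw_lin (U := K^o) (g := fun p : K^o => g x * p : K^o)) //; lin.
transitivity (sw (fun x q => sw (fun y z => (g z * r (antipode (antipode y) \ox antipode q) : K^o)) x) a).
  apply: eq_sw => x q; have := congr1 (fun p => r (p \ox antipode q)) (g_intertwine x).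
  rewrite (sw_lin (W := K^o) (g := fun p => r (p \ox antipode q) : K^o)); last lin.
  rewrite (sw_lin (W := K^o) (g := fun p => r (p \ox antipode q) : K^o)); last lin.
  have e (k : K) b c : r ((k *: b) \ox c) = k * r (b \ox c).
    by apply: (linear_scale (f := fun p => r (p \ox c) : K^o)); lin.
  under eq_sw => y z do rewrite e.
  under [RHS]eq_sw => y z do rewrite e.
  by move=> ->.
rewrite (sw_coassoc (F := fun y z q => g z * r (antipode (antipode y) \ox antipode q) : K^o)); try lin.
transitivity (sw (fun b v => sw (fun k z => sw (fun l q =>
    (r (antipode (antipode k) \ox l) * r (antipode (antipode b) \ox antipode q) : K^o)) z) v) a).
  apply: eq_sw => b v.
  rewrite -(sw_coassoc (F := fun k l q =>
    r (antipode (antipode k) \ox l) * r (antipode (antipode b) \ox antipode q) : K^o)); try lin.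
  apply: eq_sw => c q; rewrite /g (sw_lin (U := K^o)
    (g := fun p : K^o => p * r (antipode (antipode b) \ox antipode q) : K^o)); last lin.
  by apply: eq_sw => k l; rewrite [in RHS]rform_antipodel.
rewrite -(sw_coassoc (F := fun b k z => sw (fun l q =>
    (r (antipode (antipode k) \ox l) * r (antipode (antipode b) \ox antipode q) : K^o)) z)); try lin.
rewrite -[RHS](sw_counitr (U := K^o) (G := counit)); last lin.
apply: eq_sw => x z; rewrite sw_exch.
transitivity (sw (fun l q => r (antipode (antipode x) \ox (l * antipode q)) : K^o) z).
  apply: eq_sw => l q; rewrite (rform_mulr hr) [RHS](sw_antipode (U := K^o)); last lin.
  by rewrite [RHS](sw_antipode (U := K^o)) //; [apply: eq_sw => b k; rewrite mulrC | lin].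
rewrite (sw_antir (U := K^o) (G := fun p => r (antipode (antipode x) \ox p))); last lin.
by rewrite rform_1r !counit_antipode.
Qed.

(** If S(a) = 0, then g(a_(2)) S^2(a_(1)) = 0, so g(a_(1)) a_(2) = 0 by [g_intertwine]; applying x
    -> f(x_(1)) x_(2) to this returns a by [g_inv]. *)
Lemma antipode_inj : injective (antipode : A -> A).
Proof.
move=> a b /eqP; rewrite -subr_eq0 -(linear_sub _ _ (@antipode_linear K A)).
move=> /eqP e; apply/eqP; rewrite -subr_eq0; apply/eqP; move: (a - b) e => {a b} a e.
have ga : sw (fun x y => g x *: y) a = 0.
  rewrite -g_intertwine.
  (* Chosen so that G(S(c)) = g(c); the expression then depends on S(a) alone. *)
  pose G x := sw (fun y z => r (antipode (antipode z) \ox y)) x.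
  transitivity (sw (fun x y => G x *: antipode y) (antipode a)).
    rewrite sw_antipode; last by rewrite /G; lin.
    apply: eq_sw => x y; congr (_ *: _); rewrite /G [RHS](sw_antipode (U := K^o)); last lin.
    by apply: eq_sw => z w; rewrite rform_antipode rform_antipodel.
  by rewrite e /sw (linear_zero (@comul_linear K A)) (linear_zero (tlift_linear _)) // /G; lin.
transitivity (sw (fun x y => f x *: y) (sw (fun x y => g x *: y) a)); last first.
  by rewrite ga /sw (linear_zero (@comul_linear K A)) (linear_zero (tlift_linear _)) // /f; lin.
rewrite (sw_lin (g := sw (fun x y => f x *: y))); last by rewrite /f; lin.
transitivity (sw (fun x z => sw (fun y w => (g x * f y) *: w) z) a); last first.
  apply: eq_sw => x z; rewrite (linear_scale (f := sw (fun x y => f x *: y))); last by rewrite /f; lin.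
  rewrite (sw_lin (g := fun p => g x *: p)); last lin.
  by apply: eq_sw => y w; rewrite scalerA.
rewrite -(sw_coassoc (F := fun x y w => (g x * f y) *: w)); try by rewrite /f; lin.
rewrite -[LHS](sw_counitl (G := id)); last lin.
apply: eq_sw => x y; rewrite -g_inv.
by rewrite (sw_lin (U := K^o) (g := fun p : K^o => (p : K) *: y)) //; lin.
Qed.

Lemma antipode_invP a b : antipode b = a -> antipode_inv a = b.
Proof.
move=> e; rewrite /antipode_inv; case: xgetP => [c _ /= h|/(_ b) //].
by apply: antipode_inj; rewrite h.
Qed.

End UniversalRForm.

(** * Left-covariant calculi *)

Section LinearSpan.
Variable K : fieldType.
Implicit Types V W : lmodType K.

Lemma lspan_family V (S : set V) (I : finType) (b : I -> V) v :
  (forall x, S x -> exists i, x = b i) -> lspan S v ->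
  exists t : I -> K, v = \sum_i t i *: b i.
Proof.
move=> hS [s hs ->] {v}; elim: s hs => [|p s IHs] hs.
  by exists (fun=> 0); rewrite big_nil big1 // => i _; rewrite scale0r.
have [|t et] := IHs; first by move=> q qs; apply: hs; rewrite inE qs orbT.
have [i ei] := hS _ (hs p (mem_head _ _)).
exists (fun j => t j + (if j == i then p.1 else 0)).
rewrite big_cons et addrC; under [RHS]eq_bigr do rewrite scalerDl.
rewrite big_split /=; congr (_ + _); rewrite (bigD1 i) //= eqxx -ei big1 ?addr0 //.
by move=> j /negbTE ->; rewrite scale0r.
Qed.

Lemma lspan_submod V (S : set V) : GRing.submod_closed [in lspan S].
Proof.
split; first by apply/mem_set; exists [::]; rewrite ?big_nil.
move=> k x y /set_mem [s hs ->] /set_mem [t ht ->]; apply/mem_set.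
exists ([seq (k * p.1, p.2) | p <- s] ++ t).
  move=> p; rewrite mem_cat => /orP[/mapP[q qs -> /=]|]; [exact: hs | exact: ht].
rewrite big_cat big_map scaler_sumr; congr (_ + _).
by apply: eq_bigr => p _; rewrite scalerA.
Qed.

Lemma lspan_gen V (S : set V) v : S v -> lspan S v.
Proof.
by move=> Sv; exists [:: (1, v)]; [move=> p; rewrite inE => /eqP -> | rewrite big_seq1 scale1r].
Qed.

Definition spanned_by V W (f : V -> W) n (w : 'I_n -> W) :=
  forall a, exists c : 'I_n -> K, f a = \sum_i c i *: w i.

Lemma spanned_by_drop V W (f : V -> W) n (w : 'I_n.+1 -> W) c k :
  spanned_by f w -> \sum_i c i *: w i = 0 -> c k != 0 ->
  spanned_by f (fun i => w (lift k i)).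
Proof.
move=> hw; rewrite (bigD1_ord k) //= => /eqP; rewrite addr_eq0 => /eqP e ck a.
have [d ->] := hw a; exists (fun i => d (lift k i) - d k / c k * c (lift k i)).
rewrite (bigD1_ord k) //= -[w k](scalerK ck) e !scalerN scalerA scaler_sumr.
rewrite addrC -sumrB; apply: eq_bigr => i _.
by rewrite scalerBl !scalerA.
Qed.

(** Vectors are dropped along nontrivial relations until none remains. Independence makes
    coordinates well defined in [tangent_dual_basis]. *)
Lemma spanned_by_basis V W (f : V -> W) n (w : 'I_n -> W) : spanned_by f w ->
  exists m (b : 'I_m -> W), spanned_by f b /\
    forall c : 'I_m -> K, \sum_i c i *: b i = 0 -> forall i, c i = 0.
Proof.
elim: n w => [|n IHn] w hw; first by exists 0%N, w; split=> // c _ [].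
have [[c [k [e ck]]]|h] := pselect (exists c k, \sum_i c i *: w i = 0 /\ c k != 0).
  exact: IHn (spanned_by_drop hw e ck).
exists n.+1, w; split=> // c e k; apply/eqP; apply: contrapT => /negP ck.
by apply: h; exists c, k.
Qed.

Lemma lspan_image V W (S : set V) (T : set W) (f : V -> W) v : linear f ->
  (forall x, S x -> lspan T (f x)) -> lspan S v -> lspan T (f v).
Proof.
move=> hf hS [s hs ->]; have [T0 TD] := lspan_submod T.
elim: s hs => [|p s IHs] hs; first by rewrite big_nil (linear_zero hf); apply: set_mem.
rewrite big_cons hf; apply/set_mem/TD; apply/mem_set.
  exact/hS/hs/mem_head.
by apply: IHs => q qs; apply: hs; rewrite inE qs orbT.
Qed.

(** Lists are concatenated for sums, and a scalar goes into the left leg, whence the condition on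
    [P]. *)
Lemma tensor_of_sets_submod V W (P : set V) (Q : set W) :
  (forall k x, P x -> P (k *: x)) ->
  GRing.submod_closed [in tensor_of_sets P Q].
Proof.
move=> PZ; split; first by apply/mem_set; exists [::]; rewrite ?big_nil.
move=> k x y /set_mem [s hs ->] /set_mem [t ht ->]; apply/mem_set.
exists ([seq (k *: p.1, p.2) | p <- s] ++ t).
  move=> p; rewrite mem_cat => /orP[/mapP[q qs -> /=]|]; last exact: ht.
  by have [? ?] := hs _ qs; split=> //; apply: PZ.
rewrite big_cat big_map scaler_sumr; congr (_ + _).
apply: eq_bigr => p _ /=.
by rewrite (linear_scale (f := fun x => x \ox p.2)) //; lin.
Qed.

Lemma tensor_of_sets_pure V W (P : set V) (Q : set W) x y :
  P x -> Q y -> tensor_of_sets P Q (x \ox y).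
Proof.
by move=> Px Qy; exists [:: (x, y)]; [move=> p; rewrite inE => /eqP -> | rewrite big_seq1].
Qed.

Lemma submod_closed_sum V (S : set V) (I : eqType) (s : seq I) (F : I -> V) :
  GRing.submod_closed [in S] -> (forall i, i \in s -> S (F i)) ->
  S (\sum_(i <- s) F i).
Proof.
move=> [S0 SD] h; rewrite big_seq; apply: (big_ind S) => [|x y Sx Sy|i /h //].
  exact: set_mem.
by rewrite -[x]scale1r; apply/set_mem/SD; apply/mem_set.
Qed.

End LinearSpan.

(** * The map omega, the coaction, and forms dual to tangent functionals *)

Section CovariantCalculus.
Variables (K : fieldType) (A : hopfAlgType K) (Gam : calculus_ops A).
Hypothesis hG : fodc_on [set: A] [set: Gam].
Implicit Types (a b x y : A) (g h : Gam).

Local Notation "x *L g" := (lact (c := Gam) x g) (at level 40).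
Local Notation "g *R x" := (ract (c := Gam) g x) (at level 40).
Local Notation d := (@diff K A Gam).
Local Notation om := (omega Gam).

Lemma lact_bilinear : bilinear (lact (c := Gam)).
Proof.
split=> [g k x y|x k g h].
  exact: (bimod_lactDl (fodc_bimod hG) k (g := g) I I I).
exact: (bimod_lactDr (fodc_bimod hG) k (x := x) I I I).
Qed.

Lemma ract_bilinear : bilinear (ract (c := Gam)).
Proof.
split=> [x k g h|g k x y].
  exact: (bimod_ractDl (fodc_bimod hG) k (x := x) I I I).
exact: (bimod_ractDr (fodc_bimod hG) k (g := g) I I I).
Qed.

Lemma diff_linear : linear d.
Proof. by move=> k x y; apply: (fodc_linear hG). Qed.

Lemma lact1 g : 1 *L g = g. Proof. exact: (bimod_lact1 (fodc_bimod hG)). Qed.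
Lemma ract1 g : g *R 1 = g. Proof. exact: (bimod_ract1 (fodc_bimod hG)). Qed.

Lemma lactM x y g : (x * y) *L g = x *L (y *L g).
Proof. exact: (bimod_lactM (fodc_bimod hG)). Qed.

Lemma ractM x y g : g *R (x * y) = g *R x *R y.
Proof. exact: (bimod_ractM (fodc_bimod hG)). Qed.

Lemma lractA x y g : (x *L g) *R y = x *L (g *R y).
Proof. exact: (bimod_assoc (fodc_bimod hG)). Qed.

Lemma diffM x y : d (x * y) = x *L d y + d x *R y.
Proof. exact: (fodc_leibniz hG). Qed.

Lemma diff1 : d 1 = 0.
Proof.
have /eqP := diffM 1 1; rewrite mulr1 lact1 ract1 -subr_eq0 opprD addNKr oppr_eq0.
by move/eqP.
Qed.

Let hl := lact_bilinear.
Let hrt := ract_bilinear.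
Let hd := diff_linear.

Lemma lactZl k x g : (k *: x) *L g = k *: (x *L g).
Proof. exact: (linear_scale _ _ (hl.1 g)). Qed.

Lemma lactZr k x g : x *L (k *: g) = k *: (x *L g).
Proof. exact: (linear_scale _ _ (hl.2 x)). Qed.

Lemma omega_linear : linear om.
Proof. by rewrite /omega; lin. Qed.

Lemma omega1 : om 1 = 0.
Proof. by rewrite /omega sw_1; [rewrite diff1 (linear_zero (hl.2 _)) | lin]. Qed.

Lemma diff_omega a : d a = sw (fun x y => x *L om y) a.
Proof.
transitivity (sw (fun x v => sw (fun y z => (x * antipode y) *L d z) v) a).
  by rewrite (sw_antirC (F := fun p z => p *L d z)) ?lact1 //; lin.
apply: eq_sw => x v; rewrite /omega (sw_lin (g := lact (c := Gam) x)); last exact: hl.2.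
by apply: eq_sw => y z; rewrite lactM.
Qed.

(** Cancelling b_(1) S(b_(2)) gives b_(1) omega(a b_(2)) = S(a_(1)) d(a_(2) b), which the Leibniz
    rule splits into the other two terms. *)
Lemma omega_ract a b :
  om a *R b = sw (fun x y => x *L om (a * y)) b - counit a *: d b.
Proof.
apply/eqP; rewrite eq_sym subr_eq; apply/eqP.
transitivity (sw (fun p q => antipode p *L d (q * b)) a).
  transitivity (sw (fun p q => sw (fun x v => sw (fun s t =>
      ((x * antipode s) * antipode p) *L d (q * t)) v) b) a).
    rewrite sw_exch; apply: eq_sw => x v.
    rewrite /omega sw_mul; last lin.
    rewrite (sw_lin (g := lact (c := Gam) x)); last exact: hl.2.
    apply: eq_sw => p q; rewrite (sw_lin (g := lact (c := Gam) x)); last exact: hl.2.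
    by apply: eq_sw => s t; rewrite antipodeM !lactM.
  apply: eq_sw => p q.
  by rewrite (sw_antirC (F := fun z t => (z * antipode p) *L d (q * t))) ?mul1r //; lin.
transitivity (sw (fun p q => (antipode p * q) *L d b) a +
              sw (fun p q => (antipode p *L d q) *R b) a).
  rewrite /sw /tlift /fsum -big_split; apply: eq_bigr => p _ /=.
  by rewrite diffM (linear_add _ _ (hl.2 _)) lactM lractA.
rewrite addrC; congr (_ + _).
  by rewrite /omega (sw_lin (g := fun g => g *R b)) //; apply: hrt.1.
by rewrite (sw_antil (G := fun p => p *L d b)) ?lact1 //; lin.
Qed.

(** The elements x dy suffice because x dy z = x d(yz) - xy dz. *)
Lemma fodc_ind X (G : set Gam) (P : Gam -> Prop) : fodc_on X G -> P 0 ->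
  (forall k g h, P g -> P h -> P (k *: g + h)) ->
  (forall x y, X x -> X y -> P (x *L d y)) -> forall g, G g -> P g.
Proof.
move=> hX P0 PD Pd g; rewrite (fodc_span hX) => -[s hs ->].
elim: s hs => [|p s IHs] hs; first by rewrite big_nil.
rewrite big_cons; apply: (PD); last first.
  by apply: IHs => q qs; apply: hs; rewrite inE qs orbT.
have [x [y [z [Xx Xy Xz ->]]]] := hs p (mem_head _ _).
have -> : (x *L d y) *R z = (-1) *: ((x * y) *L d z) + x *L d (y * z).
  rewrite diffM (linear_add _ _ (hl.2 _)) lactM lractA scaleN1r.
  by rewrite addKr.
have [[_ _ XM] _ _ _ _ _] := hX.
apply: PD; apply: Pd => //.
  by apply/set_mem/XM; apply/mem_set.
by apply/set_mem/XM; apply/mem_set.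
Qed.

Section Coaction.
Variable Phi : Gam -> A \ox Gam.
Hypothesis hPhi : left_coaction_on [set: A] [set: Gam] Phi.

Lemma coaction_linear : linear Phi.
Proof. by move=> k g h; apply: (coact_linear hPhi). Qed.
Let hp := coaction_linear.

Lemma coaction_diff x y : Phi (x *L d y) =
  sw (fun x1 x2 => sw (fun y1 y2 => (x1 * y1) \ox (x2 *L d y2)) y) x.
Proof.
by apply: (coact_diff hPhi (s := repr (comul x)) (t := repr (comul y))) => //;
  apply: comul_sw.
Qed.

(** Phi(omega(a)) = S(a_(2)) a_(3) ⊗ S(a_(1)) d a_(4), where the left leg cancels. *)
Lemma omega_left_invariant a : left_invariant Phi (om a).
Proof.
rewrite /left_invariant /= /omega (sw_lin (g := Phi)) //.
transitivity (sw (fun x v => sw (fun p q => sw (fun v1 v2 =>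
    (antipode q * v1) \ox (antipode p *L d v2)) v) x) a).
  by apply: eq_sw => x v; rewrite coaction_diff sw_antipode; last lin.
rewrite (sw_coassoc (F := fun p q v => sw (fun v1 v2 =>
    (antipode q * v1) \ox (antipode p *L d v2)) v)); try lin.
rewrite (sw_lin (g := fun g => 1 \ox g)); last lin.
apply: eq_sw => p z.
by rewrite (sw_antilC (F := fun y v => y \ox (antipode p *L d v))) //; lin.
Qed.

(* S(g_(-1)) g_(0), the projection of Gam onto the left-invariant forms. *)
Let proj g : Gam := tlift (fun a h => antipode a *L h) (Phi g).

Let proj_linear : linear proj.
Proof. by rewrite /proj; lin. Qed.

Let proj_diff x y : proj (x *L d y) = counit x *: om y.
Proof.
have hF : bilinear (fun a (h : Gam) => antipode a *L h) by lin.
rewrite /proj coaction_diff (sw_lin (g := tlift (fun a (h : Gam) => antipode a *L h))); last exact: tlift_linear.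
transitivity (sw (fun y1 y2 => sw (fun x1 x2 =>
    (antipode y1 * (antipode x1 * x2)) *L d y2) x) y).
  rewrite [RHS]sw_exch; apply: eq_sw => x1 x2.
  rewrite (sw_lin (g := tlift (fun a (h : Gam) => antipode a *L h))); last exact: tlift_linear.
  by apply: eq_sw => y1 y2; rewrite tlift_pure // antipodeM !lactM.
rewrite /omega (sw_lin (g := fun g => counit x *: g)); last lin.
apply: eq_sw => y1 y2.
by rewrite (sw_antil (G := fun p => (antipode y1 * p) *L d y2)) ?mulr1 //; lin.
Qed.

(** As proj(x dy) = omega(eps(x) y), functionals that factor through omega can be evaluated on
    projected forms. *)
Let proj_omega g : exists a, om a = proj g.
Proof.
apply: (fodc_ind (P := fun g => exists a, om a = proj g) hG) => //.
- by exists 0; rewrite (linear_zero omega_linear) (linear_zero proj_linear).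
- move=> k {}g h [a ea] [b eb]; exists (k *: a + b).
  by rewrite omega_linear proj_linear ea eb.
- by move=> x y _ _; exists (counit x *: y); rewrite proj_diff (linear_scale _ _ omega_linear).
Qed.

(** The definition controls X only on the kernel of eps; subtracting eps(a - b) 1, on which X and
    omega vanish, reduces to that case. *)
Lemma tangent_omega (X : A -> K^o) a b :
  quantum_tangent_space Gam X -> om a = om b -> X a = X b.
Proof.
move=> [hX X1 Xo] e; apply/eqP; rewrite -subr_eq0 -(linear_sub _ _ hX).
have hc : linear (counit : A -> K^o) by lin.
have : X (a - b - counit (a - b) *: 1) = 0.
  apply: Xo.
    rewrite (linear_sub (f := (counit : A -> K^o))) //.
    by rewrite (linear_scale (f := (counit : A -> K^o))) // counit1 [_ *: _]mulr1 subrr.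
  rewrite !(linear_sub _ _ omega_linear) (linear_scale _ _ omega_linear) omega1.
  by rewrite scaler0 subr0 e subrr.
by rewrite [X in X = 0](linear_sub _ _ hX) (linear_scale _ _ hX) X1 scaler0 subr0 => ->.
Qed.

(* The component of a form along the left-invariant form dual to [X]. *)
Lemma tangent_component (X : A -> K^o) : quantum_tangent_space Gam X ->
  exists2 Psi : Gam -> A, linear Psi &
    forall a b, Psi (a *L om b) = (X b : K) *: a.
Proof.
move=> hT; have [hX X1 _] := hT.
have Xom a b : om a = om b -> X a = X b.
  exact: tangent_omega.
(* [s] need not be linear, but X(s(g)) depends only on omega(s(g)) = proj g and is therefore linear
   in g. *)
have [s hs] := choice proj_omega.
have th g a : om a = proj g -> X (s g) = X a by move=> e; apply: Xom; rewrite hs.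
have hth : linear (fun g => X (s g)).
  move=> k g h; rewrite -hX; apply: th.
  by rewrite omega_linear !hs proj_linear.
(* Psi(g) = g_(-1) X(s(g_(0))). *)
pose Psi g : A := tlift (fun a h => (X (s h) : K) *: a) (Phi g).
have hF : bilinear (fun a (h : Gam) => (X (s h) : K) *: a) by lin.
have hPsi : linear Psi by rewrite /Psi; lin.
have PsiE a b : Psi (a *L d b) = sw (fun b1 b2 => (X b2 : K) *: (a * b1)) b.
  rewrite /Psi coaction_diff (sw_lin (g := tlift _)); last exact: tlift_linear.
  transitivity (sw (fun b1 b2 => sw (fun a1 a2 => counit a2 *: ((X b2 : K) *: (a1 * b1))) a) b).
    rewrite [RHS]sw_exch; apply: eq_sw => a1 a2.
    rewrite (sw_lin (g := tlift _)); last exact: tlift_linear.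
    apply: eq_sw => b1 b2; rewrite tlift_pure // (th _ (counit a2 *: b2)).
      by rewrite (linear_scale _ _ hX) scalerA.
    by rewrite proj_diff (linear_scale _ _ omega_linear).
  by apply: eq_sw => b1 b2; rewrite (sw_counitr (G := fun p => (X b2 : K) *: (p * b1))) //; lin.
exists Psi => // a b; rewrite /omega (sw_lin (g := lact (c := Gam) a)); last exact: hl.2.
rewrite (sw_lin (g := Psi)) //.
transitivity (sw (fun x v => sw (fun y z => (X z : K) *: (a * (antipode x * y))) v) b).
  by apply: eq_sw => x v; rewrite -lactM PsiE; apply: eq_sw => y z; rewrite mulrA.
rewrite (sw_antilC (F := fun p z => (X z : K) *: (a * p))) ?mulr1 //; lin.
Qed.

(** The coordinates of omega in an independent family spanning its values are tangent functionals,
    hence combinations of the X_j; exchanging the two sums collects the forms [w]. *)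
Lemma tangent_dual_basis m (X : 'I_m -> A -> K^o) :
  finite_dim (left_invariant Phi) ->
  quantum_tangent_space Gam `<=` lspan (range X) ->
  exists w : 'I_m -> Gam, forall a, om a = \sum_i (X i a : K) *: w i.
Proof.
move=> [s hs] hT.
have h0 : spanned_by om (fun i : 'I_(size s) => s`_i).
  move=> a; apply: (lspan_family (S := [set` s])); last exact/hs/omega_left_invariant.
  move=> x /= xs; have lt : (index x s < size s)%N by rewrite index_mem.
  by exists (Ordinal lt); rewrite /= nth_index.
have [n [w [hw uw]]] := spanned_by_basis h0.
have [c hc] := choice hw.
have cu e a : om a = \sum_i e i *: w i -> forall i, c a i = e i.
  move=> ea i; apply/eqP; rewrite -subr_eq0; apply/eqP.
  apply: (uw (fun i => c a i - e i)).
  by under eq_bigr do rewrite scalerBl; rewrite sumrB -hc -ea subrr.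
have cT i : quantum_tangent_space Gam (fun a => c a i).
  split.
  - move=> k a b /=; rewrite (cu (fun i => k * c a i + c b i)) // omega_linear.
    under [RHS]eq_bigr do rewrite scalerDl -scalerA.
    by rewrite big_split -scaler_sumr -!hc.
  - by rewrite (cu (fun=> 0)) // omega1 big1 // => j _; rewrite scale0r.
  - by move=> a _ ea; rewrite (cu (fun=> 0)) // ea big1 // => j _; rewrite scale0r.
have tP i : exists t : 'I_m -> K, (fun a => c a i) = \sum_j t j *: X j.
  by apply: lspan_family (hT _ (cT i)) => x [j _ <-]; exists j.
have [t ht] := choice tP.
exists (fun j => \sum_i t i j *: w i) => a.
under eq_bigr do rewrite scaler_sumr.
rewrite exchange_big [LHS]hc; apply: eq_bigr => i _.
rewrite -[c a i]/((fun a => c a i) a) ht fct_sumE scaler_suml.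
by apply: eq_bigr => j _; rewrite scalerA mulrC.
Qed.

Lemma XdXX_fodc (X : set A) : GRing.subalg_closed [in X] -> fodc_on X (XdXX (Gam := Gam) X).
Proof.
move=> hX; have [X1 _ XM] := hX.
have {}XM x y : X x -> X y -> X (x * y).
  by move=> Xx Xy; apply/set_mem/XM; apply/mem_set.
have hB := fodc_bimod hG.
split=> //; last 3 first.
- move=> x Xx; apply: lspan_gen; exists 1, x, 1.
  by rewrite lact1 ract1; split=> //; apply: set_mem.
- by move=> k x y _ _; apply: hd.
- by move=> x y _ _; apply: diffM.
split.
- exact: lspan_submod.
- move=> x g Xx; apply: lspan_image; first exact: hl.2.
  move=> _ [a [b [c [Xa Xb Xc ->]]]]; apply: lspan_gen; exists (x * a), b, c.
  by rewrite !lractA lactM; split=> //; apply: XM.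
- move=> x g Xx; apply: (lspan_image (f := fun g => g *R x)); first exact: hrt.1.
  move=> _ [a [b [c [Xa Xb Xc ->]]]]; apply: lspan_gen; exists a, b, (c * x).
  by rewrite ractM; split=> //; apply: XM.
- by move=> k x y g _ _ _; apply: (hl.1 g).
- by move=> k x g h _ _ _; apply: (hl.2 x).
- by move=> k x y g _ _ _; apply: (hrt.2 g).
- by move=> k x g h _ _ _; apply: (hrt.1 x).
- by move=> g _; apply: lact1.
- by move=> g _; apply: ract1.
- by move=> x y g _ _ _; apply: lactM.
- by move=> x y g _ _ _; apply: ractM.
- by move=> x y g _ _ _; apply: lractA.
Qed.

(** [Phi] itself restricts: on x dy its value is x_(1) y_(1) ⊗ x_(2) dy_(2), with x_(2) and y_(2) in
    [X]. *)
Lemma XdXX_left_covariant (X : set A) : GRing.subalg_closed [in X] ->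
  (forall x, X x -> tensor_of_sets setT X (comul x)) ->
  left_covariant_fodc_on X (XdXX (Gam := Gam) X).
Proof.
move=> hX hc; have hXG := XdXX_fodc hX; split=> //; exists Phi; split=> //.
- have hS : GRing.submod_closed [in tensor_of_sets (setT : set A) (XdXX (Gam := Gam) X)].
    exact: (@tensor_of_sets_submod K A Gam).
  apply: (fodc_ind hXG) => [|k g h Sg Sh|x y Xx Xy].
  + by rewrite (linear_zero hp); have [S0 _] := hS; apply: set_mem.
  + by rewrite hp; have [_ SD] := hS; apply/set_mem/SD; apply/mem_set.
  have [[s hs es] [t ht et]] := (hc x Xx, hc y Xy).
  rewrite (coact_diff hPhi (s := s) (t := t)) //.
  apply: submod_closed_sum => // p ps; apply: submod_closed_sum => // q qt.
  apply: tensor_of_sets_pure => //; apply: (bimod_lact (fodc_bimod hXG)).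
    by have [] := hs _ ps.
  by apply: (fodc_diff hXG); have [] := ht _ qt.
- by move=> k g h _ _; apply: hp.
- by move=> x y s t _ _ hs es ht et; apply: (coact_diff hPhi).
Qed.

End Coaction.
End CovariantCalculus.

(** * L-functionals *)

Section MatrixCorepresentation.
Variables (K : fieldType) (A : hopfAlgType K) (n : nat) (u : 'M[A]_n).
Hypothesis hu : matrix_corep u.
Implicit Types U : lmodType K.

Lemma sw_corep U (F : A -> A -> U) i j : bilinear F ->
  sw F (u i j) = \sum_k F (u i k) (u k j).
Proof.
move=> hF; rewrite /sw (hu i j).1 (linear_bigsum _ _ _ (tlift_linear hF)).
by apply: eq_bigr => k _; rewrite tlift_pure.
Qed.

Lemma sw_antipode_corep U (F : A -> A -> U) i j : bilinear F ->
  sw F (antipode (u i j)) = \sum_k F (antipode (u k j)) (antipode (u i k)).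
Proof. by move=> hF; rewrite sw_antipode // sw_corep //; lin. Qed.

Lemma corep_antil i j : \sum_k antipode (u i k) * u k j = (i == j)%:R.
Proof.
rewrite -(sw_corep (F := fun x y => antipode x * y)); last lin.
by rewrite (sw_antil (G := id)) // (hu i j).2 scaler_nat.
Qed.

Lemma corep_antir i j : \sum_k u i k * antipode (u k j) = (i == j)%:R.
Proof.
rewrite -(sw_corep (F := fun x y => x * antipode y)); last lin.
by rewrite (sw_antir (G := id)) // (hu i j).2 scaler_nat.
Qed.

End MatrixCorepresentation.

Section GeneratedSubalgebra.
Variables (K : fieldType) (A : hopfAlgType K).
Implicit Types S X : set A.

Lemma gen_subalg_closed S : GRing.subalg_closed [in gen_subalg S].
Proof.
split.
- by apply/mem_set => X [X1 _ _] _; apply: set_mem.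
- move=> k x y /set_mem Sx /set_mem Sy; apply/mem_set => X hX SX.
  by have [_ XD _] := hX; apply/set_mem/XD; apply/mem_set; [apply: Sx | apply: Sy].
- move=> x y /set_mem Sx /set_mem Sy; apply/mem_set => X hX SX.
  by have [_ _ XM] := hX; apply/set_mem/XM; apply/mem_set; [apply: Sx | apply: Sy].
Qed.

Lemma gen_subalg_gen S x : S x -> gen_subalg S x.
Proof. by move=> Sx X _; apply. Qed.

Lemma gen_subalg_ind S (P : A -> Prop) : P 1 ->
  (forall k x y, gen_subalg S x -> gen_subalg S y -> P x -> P y -> P (k *: x + y)) ->
  (forall x y, gen_subalg S x -> gen_subalg S y -> P x -> P y -> P (x * y)) ->
  (forall x, S x -> P x) -> forall x, gen_subalg S x -> P x.
Proof.
move=> P1 PD PM PS x Sx; have [S1 SD SM] := gen_subalg_closed S.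
(* [gen_subalg] is an intersection; membership is carried along so that the induction steps may use
   it. *)
suff [] : [set x | gen_subalg S x /\ P x] x by [].
apply: Sx => [|z Sz]; last by split; [apply: gen_subalg_gen | apply: PS].
split.
- by apply/mem_set; split=> //; apply: set_mem.
- move=> k a c /set_mem[Sa Pa] /set_mem[Sc Pc]; apply/mem_set; split; last exact: PD.
  by apply/set_mem/SD; apply/mem_set.
- move=> a c /set_mem[Sa Pa] /set_mem[Sc Pc]; apply/mem_set; split; last exact: PM.
  by apply/set_mem/SM; apply/mem_set.
Qed.

Lemma gen_subalg_comul S : (forall x, S x -> tensor_of_sets setT (gen_subalg S) (comul x)) ->
  forall x, gen_subalg S x -> tensor_of_sets setT (gen_subalg S) (comul x).
Proof.
have [S1 SD SM] := gen_subalg_closed S.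
have hT : GRing.submod_closed [in tensor_of_sets (setT : set A) (gen_subalg S)].
  exact: tensor_of_sets_submod.
move=> hS; apply: gen_subalg_ind => // [|k x y _ _ hx hy|x y _ _ [s hs es] [t ht et]].
- by rewrite comul1; apply: tensor_of_sets_pure => //; apply: set_mem.
- by rewrite comul_linear; have [_ TD] := hT; apply/set_mem/TD; apply/mem_set.
rewrite comul_sw sw_mul; last lin.
rewrite (sw_pure _ es); last lin.
apply: submod_closed_sum => // p ps; rewrite (sw_pure _ et); last lin.
apply: submod_closed_sum => // q qt; apply: tensor_of_sets_pure => //.
by apply/set_mem/SM; apply/mem_set; [have [] := hs _ ps | have [] := ht _ qt].
Qed.

End GeneratedSubalgebra.

Section LFunctionals.
Variables (K : fieldType) (A : hopfAlgType K) (r rbar : {scalar (A \ox A)%type}).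
Hypothesis hr : universal_rform r rbar.
Variables (n : nat) (u : 'M[A]_n.+1).
Hypothesis hu : matrix_corep u.
Local Notation N := (ord_max : 'I_n.+1).
Local Notation lp := (lplus r u).
Local Notation lm := (lminus rbar u).
Hypothesis lm0 : forall (m : 'I_n.+1) a, (m < N)%N -> lm m N a = 0.
Hypothesis lmS : forall a, lm N N (antipode a) = lp N N a.
Variable gamma : 'I_n.+1 -> K.
Hypothesis gamma_neq0 : forall i, gamma i != 0.
Hypothesis SSu : forall i j,
  antipode (antipode (u i j)) = (gamma i * (gamma j)^-1) *: u i j.
Hypothesis lp0 : forall i j, i != j -> lp i N (u N j) = 0.
Hypothesis beta_neq0 : beta r u != 0.
Hypothesis lp_beta : forall i, i != N -> conv (lp N N) (lp i N) (u N i) = beta r u.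

Let ltN (i : 'I_n.+1) : i != N -> (i < N)%N.
Proof. by rewrite ltn_neqAle -ltnS ltn_ord andbT. Qed.

(** Of the terms l^{-n}_k(a) l^{-k}_n(b) only k = n survives, by triangularity. *)
Lemma lminusM a b : lm N N (a * b) = lm N N a * lm N N b.
Proof.
rewrite /lminus (rbar_mulr hr) [LHS](sw_corep hu (U := K^o)) //; last lin.
rewrite (bigD1 N) //= big1 ?addr0 // => k kN.
by have := lm0 b (ltN kN); rewrite /lminus => ->; rewrite mulr0.
Qed.

(* S(l^{+j}_k) l^{-n}_n *)
Definition Lfun (j k : 'I_n.+1) : A -> K^o := conv (fantipode (lp j k)) (lm N N).

Lemma Lfun_linear j k : linear (Lfun j k).
Proof. by rewrite /Lfun /conv /fantipode /lplus /lminus; lin. Qed.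

Lemma LfunE j k a :
  Lfun j k a = sw (fun x y => (rbar (x \ox u j k) * lm N N y : K^o)) a.
Proof.
by apply: eq_sw => x y; rewrite /fantipode /lplus (rform_antipodel hr).
Qed.

(** As S(ab) = S(b) S(a), the summation index links r(S(b), u^j_k) with r(S(a), u^k_n); [lminusM]
    splits the other factor. *)
Lemma LfunM j a b : Lfun j N (a * b) = \sum_k Lfun k N a * Lfun j k b.
Proof.
rewrite /Lfun /conv /fantipode /lplus [LHS](sw_mul (U := K^o)); last first.
  by rewrite /lminus; lin.
transitivity (sw (fun x y => sw (fun z w => (\sum_k
    (r (antipode x \ox u k N) * lm N N y) * (r (antipode z \ox u j k) * lm N N w)) : K^o) b) a).
  apply: eq_sw => x y; apply: eq_sw => z w.
  rewrite antipodeM (rform_mull hr) [X in X * _](sw_corep hu (U := K^o)) //; last lin.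
  rewrite lminusM mulr_suml; apply: eq_bigr => k _.
  by rewrite [X in X * _]mulrC mulrACA.
under eq_sw => x y do rewrite (sw_sum (U := K^o)).
rewrite (sw_sum (U := K^o)); apply: eq_bigr => k _.
rewrite [RHS](sw_lin (U := K^o) (g := fun p : K^o => p * Lfun j k b : K^o)); last lin.
apply: eq_sw => x y; rewrite [RHS](sw_lin (U := K^o) (g := fun p : K^o =>
  (r (antipode x \ox u k N) * lm N N y) * p : K^o)) //; lin.
Qed.

(** For i = n, S(l^{+n}_n) = l^{-n}_n makes L^n_n the square of l^{-n}_n. *)
Lemma Yfun_Lfun (i : 'I_n.+1) : (forall a, fantipode (lp N N) a = lm N N a) ->
  forall a, beta r u * Yfun r rbar u i a = Lfun i N a - (i == N)%:R * counit a.
Proof.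
move=> h a; rewrite /Yfun; case: eqP => [->|_]; rewrite mulrA divff // !mul1r.
  by congr (_ - _); apply: eq_sw => x y; rewrite h.
by rewrite mul0r subr0.
Qed.

Lemma lplus_NN k : lp N N (u N k) = (k == N)%:R * lp N N (u N N).
Proof.
by case: eqP => [->|/eqP kN]; rewrite ?mul1r // mul0r lp0 // eq_sym.
Qed.

Lemma conv_lplus i k : conv (lp N N) (lp i N) (u N k) = lp N N (u N N) * lp i N (u N k).
Proof.
rewrite /conv [LHS](sw_corep hu (U := K^o)) //; last by rewrite /lplus; lin.
rewrite (bigD1 N) //= big1 ?addr0 // => j jN.
by rewrite lplus_NN (negbTE jN) !mul0r.
Qed.

(** In the coproduct of S(u^n_j) only the middle index n contributes. There S(l^{+i}_n) gives
    l^{+i}_n(S^2(u^n_j)), hence the scalar gamma_n / gamma_j, and l^{-n}_n gives l^{+n}_n(u^n_n). By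
    [conv_lplus] the rest is the convolution value of hypothesis (d). *)
Lemma Yfun_dual i j : (forall a, fantipode (lp N N) a = lm N N a) ->
  Yfun r rbar u i (antipode (u N j)) = (i == j)%:R * (gamma N / gamma i).
Proof.
move=> h; apply: (mulfI beta_neq0); rewrite Yfun_Lfun //.
rewrite /Lfun /conv [X in X - _](sw_antipode_corep hu (U := K^o)); last first.
  by rewrite /fantipode /lplus /lminus; lin.
rewrite (bigD1 N) //= big1 ?addr0; last first.
  by move=> k kN; rewrite lmS lplus_NN (negbTE kN) mul0r mulr0.
rewrite lmS /fantipode SSu.
have -> : lp i N ((gamma N / gamma j) *: u N j) = gamma N / gamma j * lp i N (u N j).
  by apply: (linear_scale (f := fun x => lp i N x : K^o)); rewrite /lplus; lin.
rewrite counit_antipode (hu N j).2; case: (eqVneq i j) => [<-|ij]; last first.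
  rewrite lp0 // mulr0 !mul0r mulr0 -natrM mulnb.
  by case: eqP => // iN; case: eqP => [jN|]; rewrite ?subr0 //; rewrite iN jN eqxx in ij.
rewrite mul1r -mulrA [_ * lp N N _]mulrC -conv_lplus.
case: (eqVneq i N) => [->|iN].
  by rewrite divff // !mulr1 mul1r.
by rewrite lp_beta // mul0r subr0 mulrC.
Qed.

(** The weights compensate for the transposed indices: gamma_k^{-1} u^j_k = gamma_j^{-1} S^2(u^j_k),
    so each summand is a fixed multiple of S(S(u^j_k) u^k_i). *)
Lemma corep_twistl i j :
  \sum_k (gamma k)^-1 *: (antipode (u k i) * u j k) = ((i == j)%:R / gamma i)%:A.
Proof.
have e k : (gamma k)^-1 *: u j k = (gamma j)^-1 *: antipode (antipode (u j k)).
  by rewrite SSu scalerA mulKf.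
under eq_bigr => k _ do rewrite scalerAr e -scalerAr -antipodeM.
rewrite -scaler_sumr -(linear_bigsum _ _ _ (@antipode_linear K A)).
rewrite (corep_antil hu) eq_sym; case: eqP => [->|_].
  by rewrite antipode1 mul1r.
by rewrite mulr0n (linear_zero (@antipode_linear K A)) mul0r scale0r scaler0.
Qed.

Lemma corep_twistr i j :
  \sum_k gamma k *: (u k i * antipode (u j k)) = ((i == j)%:R * gamma i)%:A.
Proof.
have e k : gamma k *: u k i = gamma i *: antipode (antipode (u k i)).
  by rewrite SSu scalerA mulrC divfK.
under eq_bigr => k _ do rewrite scalerAl e -scalerAl -antipodeM.
rewrite -scaler_sumr -(linear_bigsum _ _ _ (@antipode_linear K A)).
rewrite (corep_antir hu) eq_sym; case: eqP => [->|_].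
  by rewrite antipode1 mul1r.
by rewrite mulr0n (linear_zero (@antipode_linear K A)) mul0r scale0r scaler0.
Qed.

(** * The calculus on A in terms of the forms w_i and dy_i *)

Section Calculus.
Hypothesis lpS : forall a, fantipode (lp N N) a = lm N N a.
Variable Gam : calculus_ops A.
Hypothesis hG : fodc_on [set: A] [set: Gam].
Variable Phi : Gam -> A \ox Gam.
Hypothesis hPhi : left_coaction_on [set: A] [set: Gam] Phi.
Local Notation Yf := (Yfun r rbar u).
Hypothesis Yf_tangent : forall i, quantum_tangent_space Gam (Yf i).
Variable w : 'I_n.+1 -> Gam.
Hypothesis omegaE : forall a, omega Gam a = \sum_i (Yf i a : K) *: w i.

Local Notation "x *L g" := (lact (c := Gam) x g) (at level 40).
Local Notation "g *R x" := (ract (c := Gam) g x) (at level 40).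
Local Notation d := (@diff K A Gam).
Local Notation om := (omega Gam).
Local Notation y := (fun i => antipode (u N i)).
Local Notation b := (beta r u).

Let hl := lact_bilinear hG.
Let hrt := ract_bilinear hG.
Let hd := diff_linear hG.
Let hLf := Lfun_linear.

(** [LfunM] with L^k_n = beta Y_k + delta_kn eps. This is the tangent space condition in the
    explicit form Delta(Y_j) - eps ⊗ Y_j = sum_k Y_k ⊗ L^j_k. *)
Lemma YfunM j a c :
  Yf j (a * c) = \sum_k Yf k a * Lfun j k c + counit a * Yf j c.
Proof.
apply: (mulfI beta_neq0); rewrite Yfun_Lfun // LfunM mulrDr mulrCA Yfun_Lfun //.
have e k : Lfun k N a = b * Yf k a + (k == N)%:R * counit a.
  by rewrite Yfun_Lfun // subrK.
under eq_bigr => k _ do rewrite e mulrDl.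
rewrite big_split /= mulr_sumr -addrA; congr (_ + _).
  by apply: eq_bigr => k _; rewrite mulrA.
rewrite (bigD1 N) //= eqxx mul1r big1 ?addr0; last first.
  by move=> k /negbTE ->; rewrite !mul0r.
by rewrite counitM mulrBr mulrCA.
Qed.

Lemma omega_y i : om (y i) = (gamma N / gamma i) *: w i.
Proof.
rewrite omegaE (bigD1 i) //= big1 ?addr0 => [|j ji].
  by rewrite Yfun_dual // eqxx mul1r.
by rewrite Yfun_dual // (negbTE ji) mul0r scale0r.
Qed.

Lemma w_omega i : w i = (gamma i / gamma N) *: om (y i).
Proof. by rewrite omega_y scalerA mulrA divfK // divff // scale1r. Qed.

Lemma omega_ract_Lfun a c : om a *R c =
  \sum_j \sum_k (Yf k a : K) *: (sw (fun x z => (Lfun j k z : K) *: x) c *L w j).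
Proof.
rewrite (omega_ract hG); apply/eqP; rewrite subr_eq; apply/eqP.
transitivity (sw (fun x z => \sum_j \sum_k
    (Yf k a : K) *: (((Lfun j k z : K) *: x) *L w j)) c
  + sw (fun x z => counit a *: (x *L om z)) c).
  rewrite /sw /tlift /fsum -big_split; apply: eq_bigr => -[x z] _ /=.
  rewrite (omegaE z) (omegaE (a * z)) !(linear_bigsum _ _ _ (hl.2 _)).
  rewrite scaler_sumr -big_split; apply: eq_bigr => j _ /=.
  rewrite YfunM !(lactZr hG) scalerDl scaler_suml scalerA; congr (_ + _).
  by apply: eq_bigr => k _; rewrite (lactZl hG) scalerA.
congr (_ + _); last first.
  rewrite (diff_omega hG) [RHS](sw_lin (g := fun p => counit a *: p)) //; lin.
rewrite sw_sum; apply: eq_bigr => j _; rewrite sw_sum; apply: eq_bigr => k _.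
rewrite (sw_lin (g := fun p => p *L w j)); last exact: hl.1.
by rewrite [RHS](sw_lin (g := fun p => (Yf k a : K) *: p)) //; lin.
Qed.

(** [omega_ract_Lfun] at a = y_i, where duality leaves only the term k = i. *)
Lemma w_ract i c :
  w i *R c = \sum_j sw (fun x z => (Lfun j i z : K) *: x) c *L w j.
Proof.
rewrite w_omega (linear_scale _ _ (hrt.1 c)) omega_ract_Lfun scaler_sumr.
apply: eq_bigr => j _; rewrite (bigD1 i) //= big1 ?addr0 => [|k ki].
  by rewrite Yfun_dual // eqxx mul1r scalerA mulrA divfK // divff // scale1r.
by rewrite Yfun_dual // (negbTE ki) mul0r scale0r.
Qed.

Lemma diff_y i :
  d (y i) = \sum_k (gamma N / gamma k) *: (antipode (u k i) *L w k).
Proof.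
have ho := omega_linear hG.
rewrite (diff_omega hG) (sw_antipode_corep hu); last lin.
by apply: eq_bigr => k _; rewrite omega_y (lactZr hG).
Qed.

(** Inverts [diff_y]: the weighted sum of u^i_k S(u^l_i) over i collapses by [corep_twistr]. *)
Lemma w_diff k : w k = \sum_i (gamma i / gamma N) *: (u i k *L d (y i)).
Proof.
transitivity (\sum_l ((gamma l)^-1 *: \sum_i gamma i *: (u i k * antipode (u l i))) *L w l).
  under eq_bigr => l _ do rewrite corep_twistr.
  rewrite (bigD1 k) //= big1 ?addr0 => [|l lk].
    by rewrite eqxx mul1r scalerA mulVf // scale1r (lact1 hG).
  rewrite eq_sym (negbTE lk) mul0r scale0r scaler0.
  exact: (linear_zero (hl.1 _)).
under [RHS]eq_bigr => i _.
  rewrite diff_y (linear_bigsum _ _ _ (hl.2 _)) scaler_sumr.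
over.
rewrite exchange_big; apply: eq_bigr => l _ /=.
rewrite scaler_sumr (linear_bigsum _ _ _ (hl.1 _)); apply: eq_bigr => i _.
rewrite !(lactZl hG) (lactZr hG) (lactM hG) !scalerA; congr (_ *: _).
by rewrite mulrA divfK // mulrC.
Qed.

(** In Sweedler notation rbar(c_(1), u^m_i) c_(2) l^{-n}_n(c_(3)); times gamma_m / gamma_i it is the
    coefficient of dy_m in dy_i c. *)
Definition ract_coef (m i : 'I_n.+1) (c : A) : A :=
  sw (fun x z => sw (fun s t => (rbar (s \ox u m i) * lm N N z) *: t) x) c.

(** L^j_k(c_(2)) contributes rbar(c_(2), u^j_k), so [rbar_comm] for c and u^m_k applies to
    rbar(c_(2), u^j_k) c_(1) u^m_j. *)
Lemma Lfun_comm k m c :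
  \sum_j sw (fun x z => (Lfun j k z : K) *: x) c * u m j =
  \sum_j u j k * ract_coef m j c.
Proof.
transitivity (sw (fun x z => lm N N z *: sw (fun s t => sw (fun p q =>
    rbar (t \ox q) *: (s * p)) (u m k)) x) c).
  under eq_bigr => j _.
    rewrite (sw_lin (g := fun p => p * u m j)); last lin.
  over.
  rewrite -(sw_sum (fun j x z => (Lfun j k z : K) *: x * u m j)).
  transitivity (sw (fun s v => sw (fun t z => lm N N z *: sw (fun p q =>
    rbar (t \ox q) *: (s * p)) (u m k)) v) c).
    apply: eq_sw => s v.
    under [RHS]eq_sw => t z.
      rewrite (sw_corep hu); last lin.
      rewrite scaler_sumr.
    over.
    rewrite sw_sum; apply: eq_bigr => j _.
    rewrite LfunE -scalerAl (sw_lin (U := K^o) (g := fun p : K^o => (p : K) *: (s * u m j))); last lin.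
    by apply: eq_sw => t z; rewrite scalerA mulrC.
  rewrite /lminus -(sw_coassoc (F := fun s t z => rbar (u N N \ox z) *: sw (fun p q =>
    rbar (t \ox q) *: (s * p)) (u m k))); try lin.
  by apply: eq_sw => x z; rewrite (sw_lin (g := fun p => rbar (u N N \ox z) *: p)) //; lin.
transitivity (sw (fun x z => lm N N z *: sw (fun s t => sw (fun p q =>
    rbar (s \ox p) *: (q * t)) (u m k)) x) c).
  by apply: eq_sw => x z; rewrite (rbar_comm hr).
under [RHS]eq_bigr => j _.
  rewrite /ract_coef (sw_lin (g := fun p => u j k * p)); last lin.
over.
rewrite -(sw_sum (fun j x z => u j k * sw (fun s t => (rbar (s \ox u m j) * lm N N z) *: t) x)).
apply: eq_sw => x z; rewrite (sw_lin (g := fun p => lm N N z *: p)); last lin.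
under [RHS]eq_bigr => j _.
  rewrite (sw_lin (g := fun p => u j k * p)); last lin.
over.
rewrite -(sw_sum (fun j s t => u j k * ((rbar (s \ox u m j) * lm N N z) *: t))).
apply: eq_sw => s t; rewrite (sw_corep hu); last lin.
rewrite scaler_sumr; apply: eq_bigr => j _.
by rewrite scalerA -scalerAr mulrC.
Qed.

(** Going to the w_k and back leaves, by [Lfun_comm], the products S(u^k_i) u^j_k; the weight
    gamma_k^{-1} from [diff_y] makes their sum over k collapse to j = i. *)
Lemma diff_y_ract i c :
  d (y i) *R c = \sum_m ((gamma m / gamma i) *: ract_coef m i c) *L d (y m).
Proof.
transitivity (\sum_k \sum_m (gamma m / gamma k) *:
    ((\sum_j antipode (u k i) * u j k * ract_coef m j c) *L d (y m))).
  rewrite {1}diff_y (linear_bigsum _ _ _ (hrt.1 _)); apply: eq_bigr => k _.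
  rewrite (linear_scale _ _ (hrt.1 _)) (lractA hG) w_ract.
  transitivity ((gamma N / gamma k) *: (antipode (u k i) *L \sum_m (gamma m / gamma N) *:
      ((\sum_j sw (fun x z => (Lfun j k z : K) *: x) c * u m j) *L d (y m)))).
    congr (_ *: (_ *L _)).
    under eq_bigr => j _ do rewrite w_diff (linear_bigsum _ _ _ (hl.2 _)).
    rewrite exchange_big; apply: eq_bigr => m _ /=.
    rewrite (linear_bigsum _ _ _ (hl.1 _)) scaler_sumr; apply: eq_bigr => j _.
    by rewrite (lactZr hG) (lactM hG).
  rewrite (linear_bigsum _ _ _ (hl.2 _)) scaler_sumr; apply: eq_bigr => m _.
  rewrite (lactZr hG) scalerA Lfun_comm -(lactM hG) mulr_sumr mulrC mulrA divfK //.
  by congr (_ *: (_ *L _)); apply: eq_bigr => j _; rewrite mulrA.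
rewrite exchange_big; apply: eq_bigr => m _ /=.
under eq_bigr => k _ do rewrite -(lactZl hG).
rewrite -(linear_bigsum _ _ _ (hl.1 _)); congr (_ *L _).
under eq_bigr => k _ do rewrite scaler_sumr.
rewrite exchange_big.
transitivity (\sum_j gamma m *: ((\sum_k (gamma k)^-1 *: (antipode (u k i) * u j k)) *
    ract_coef m j c)).
  apply: eq_bigr => j _; rewrite mulr_suml scaler_sumr; apply: eq_bigr => k _.
  by rewrite -scalerAl scalerA.
under eq_bigr => j _ do rewrite corep_twistl mulr_algl.
rewrite (bigD1 i) //= big1 ?addr0 => [|j ji].
  by rewrite eqxx mul1r scalerA.
by rewrite eq_sym (negbTE ji) mul0r scale0r scaler0.
Qed.

(** The component map of Y_k extracts sum_i c_i S(u^k_i) = 0 from the relation, since Y_k is nonzero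
    on y_k only; [corep_twistl] then inverts the matrix S(u). *)
Lemma diff_y_free (c : 'I_n.+1 -> A) :
  \sum_i c i *L d (y i) = 0 -> forall i, c i = 0.
Proof.
move=> e.
have cS k : \sum_i c i * antipode (u k i) = 0.
  have [Psi hPsi PsiE] := tangent_component hG hPhi (Yf_tangent k).
  have {}e : \sum_l (\sum_i c i * antipode (u l i)) *L om (y l) = 0.
    rewrite -[RHS]e; under [RHS]eq_bigr => i _.
      rewrite diff_y (linear_bigsum _ _ _ (hl.2 _)).
    over.
    rewrite exchange_big; apply: eq_bigr => l _ /=.
    rewrite (linear_bigsum _ _ _ (hl.1 _)); apply: eq_bigr => i _.
    by rewrite omega_y !(lactZr hG) (lactM hG).
  have := congr1 Psi e; rewrite (linear_zero hPsi) (linear_bigsum _ _ _ hPsi).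
  under eq_bigr => l _ do rewrite PsiE Yfun_dual //.
  rewrite (bigD1 k) //= [X in _ + X]big1 => [|l lk]; last first.
    by rewrite eq_sym (negbTE lk) mul0r scale0r.
  rewrite addr0 eqxx mul1r => /eqP.
  by rewrite scaler_eq0 mulf_eq0 invr_eq0 !(negbTE (gamma_neq0 _)) => /eqP.
move=> j; have H : \sum_k (gamma k)^-1 *: ((\sum_i c i * antipode (u k i)) * u j k) = 0.
  by rewrite big1 // => k _; rewrite cS mul0r scaler0.
transitivity (gamma j *: \sum_k (gamma k)^-1 *: ((\sum_i c i * antipode (u k i)) * u j k)); last first.
  by rewrite H scaler0.
transitivity (gamma j *: \sum_i c i * \sum_k (gamma k)^-1 *: (antipode (u k i) * u j k)).
  under eq_bigr => i _ do rewrite corep_twistl mulr_algr.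
  rewrite (bigD1 j) //= big1 ?addr0 => [|i ij].
    by rewrite eqxx mul1r scalerA divff // scale1r.
  by rewrite (negbTE ij) mul0r scale0r.
congr (_ *: _); under eq_bigr => i _ do rewrite mulr_sumr.
rewrite exchange_big; apply: eq_bigr => k _ /=.
rewrite mulr_suml scaler_sumr; apply: eq_bigr => i _.
by rewrite -scalerAr mulrA.
Qed.

(** S^2 merely rescales u^n_j, so S and S^{-1} agree on it up to a scalar. *)
Lemma antipode_inv_u j : antipode_inv (u N j) = (gamma j / gamma N) *: y j.
Proof.
apply: (antipode_invP hr); rewrite (linear_scale _ _ (@antipode_linear K A)) SSu.
by rewrite scalerA mulrA divfK // divff // scale1r.
Qed.

Lemma omega_antipode_inv : om (antipode_inv (u N N)) = w N.
Proof. by rewrite antipode_inv_u (linear_scale _ _ (omega_linear hG)) -w_omega. Qed.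

Lemma omega_antipode_inv_diff :
  om (antipode_inv (u N N)) = \sum_j u j N *L d (antipode_inv (u N j)).
Proof.
rewrite omega_antipode_inv w_diff; apply: eq_bigr => j _.
by rewrite antipode_inv_u (linear_scale _ _ hd) (lactZr hG).
Qed.

Lemma diff_inner z : d z = b^-1 *: (w N *R z - z *L w N).
Proof.
rewrite w_ract (diff_omega hG).
apply: (scalerI beta_neq0); rewrite scalerA divff // scale1r.
apply/esym/eqP; rewrite subr_eq; apply/eqP.
transitivity (\sum_j ((b *: sw (fun x v => (Yf j v : K) *: x) z) *L w j + ((j == N)%:R *: z) *L w j)).
  apply: eq_bigr => j _; rewrite -(linear_add _ _ (hl.1 _)); congr (_ *L _).
  have hY : linear (Yf j) by case: (Yf_tangent j).
  have -> : (j == N)%:R *: z = sw (fun x v => (j == N)%:R *: (counit v *: x)) z.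
    rewrite -(sw_lin (g := fun p => (j == N)%:R *: p) (fun x v => counit v *: x)); last lin.
    by rewrite (sw_counitr (G := id)).
  rewrite (sw_lin (g := fun p => b *: p)); last lin.
  rewrite /sw /tlift /fsum -big_split; apply: eq_bigr => -[x v] _ /=.
  rewrite !scalerA -scalerDl Yfun_Lfun //.
  by rewrite subrK.
rewrite big_split /=; congr (_ + _).
  rewrite (sw_lin (g := fun p => b *: p)); last lin.
  under [RHS]eq_sw => x v.
    rewrite omegaE (linear_bigsum _ _ _ (hl.2 _)) scaler_sumr.
  over.
  rewrite sw_sum; apply: eq_bigr => j _.
  rewrite (lactZl hG) (sw_lin (g := fun p => p *L w j)); last exact: hl.1.
  rewrite (sw_lin (g := fun p => b *: p)); last lin.
  by apply: eq_sw => x v; rewrite (lactZl hG) (lactZr hG).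
rewrite (bigD1 N) //= big1 ?addr0 => [|j /negbTE ->].
  by rewrite eqxx scale1r.
by rewrite scale0r (linear_zero (hl.1 _)).
Qed.

(** The factor gamma_m / gamma_i turns u^m_i into S^2(u^m_i), and rbar(S(u^k_j), S^2(u^m_i)) =
    r(u^k_j, u^m_i). Moreover l^{-n}_n(S(u^n_k)) = l^{+n}_n(u^n_k) vanishes unless k = n. *)
Lemma ract_coef_y m i j : (gamma m / gamma i) *: ract_coef m i (y j) =
  lp N N (u N N) *: \sum_k r (u k j \ox u m i) *: y k.
Proof.
rewrite /ract_coef (sw_antipode_corep hu); last by rewrite /lminus; lin.
rewrite (bigD1 N) //= big1 ?addr0 => [|k kN]; last first.
  rewrite lmS lplus_NN (negbTE kN) mul0r /sw /tlift /fsum big1 // => p _.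
  by rewrite mulr0 scale0r.
rewrite (sw_antipode_corep hu); last lin.
rewrite !scaler_sumr; apply: eq_bigr => k _.
rewrite !scalerA lmS; congr (_ *: _).
rewrite [RHS]mulrC mulrA; congr (_ * _).
have -> : gamma m / gamma i * rbar (antipode (u k j) \ox u m i) =
    rbar (antipode (u k j) \ox ((gamma m / gamma i) *: u m i)).
  by rewrite [RHS](linear_scale (f := fun p => rbar (antipode (u k j) \ox p) : K^o)) //; lin.
by rewrite -SSu (rbar_antipoder hr) (rform_antipode hr).
Qed.

Lemma diff_y_ract_y i j : d (y i) *R y j =
  lp N N (u N N) *: \sum_k \sum_m Rhat r u m k j i *: (y k *L d (y m)).
Proof.
rewrite diff_y_ract exchange_big scaler_sumr; apply: eq_bigr => m _ /=.
rewrite ract_coef_y (lactZl hG) (linear_bigsum _ _ _ (hl.1 _)); congr (_ *: _).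
by apply: eq_bigr => k _; rewrite (lactZl hG).
Qed.

Lemma ract_coefE m i c : (gamma m / gamma i) *: ract_coef m i c =
  sw (fun z1 z' => sw (fun z2 z3 =>
    (gamma m / gamma i * rbar (z1 \ox u m i) * lm N N z3) *: z2) z') c.
Proof.
rewrite /ract_coef /lminus (sw_coassoc (F := fun s t z =>
  (rbar (s \ox u m i) * rbar (u N N \ox z)) *: t)); try lin.
rewrite (sw_lin (g := fun p => (gamma m / gamma i) *: p)); last lin.
apply: eq_sw => s v; rewrite (sw_lin (g := fun p => (gamma m / gamma i) *: p)); last lin.
by apply: eq_sw => t z; rewrite scalerA mulrA.
Qed.

(** * The left span of the dy_i over the subalgebra [Y] *)

Local Notation Y := (gen_subalg (range y)).

Let Y1 : Y 1. Proof. by have [h _ _] := gen_subalg_closed (range y); apply: set_mem. Qed.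
Let YD k x z : Y x -> Y z -> Y (k *: x + z).
Proof.
by move=> ? ?; have [_ h _] := gen_subalg_closed (range y); apply/set_mem/h; apply/mem_set.
Qed.
Let YM x z : Y x -> Y z -> Y (x * z).
Proof.
by move=> ? ?; have [_ _ h] := gen_subalg_closed (range y); apply/set_mem/h; apply/mem_set.
Qed.
Let Y0 : Y 0. Proof. by rewrite -[0](addNr 1) -scaleN1r; apply: YD. Qed.
Let Yy i : Y (y i). Proof. by apply: gen_subalg_gen; exists i. Qed.

Let dyspan : set Gam :=
  [set g | exists2 c : 'I_n.+1 -> A, (forall i, Y (c i)) & g = \sum_i c i *L d (y i)].

Let dyspanD k g h : dyspan g -> dyspan h -> dyspan (k *: g + h).
Proof.
move=> [c Yc ->] [e Ye ->]; exists (fun i => k *: c i + e i) => [i|]; first exact: YD.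
rewrite scaler_sumr -big_split; apply: eq_bigr => i _.
by rewrite (hl.1 _ k).
Qed.

Let dyspan_submod : GRing.submod_closed [in dyspan].
Proof.
split=> [|k g h /set_mem hg /set_mem hh]; last by apply/mem_set; apply: dyspanD.
apply/mem_set; exists (fun=> 0) => //; rewrite big1 // => i _.
exact: (linear_zero (hl.1 _)).
Qed.

Let dyspan_lact x g : Y x -> dyspan g -> dyspan (x *L g).
Proof.
move=> Yx [c Yc ->]; exists (fun i => x * c i) => [i|]; first exact: YM.
rewrite (linear_bigsum _ _ _ (hl.2 _)); apply: eq_bigr => i _.
by rewrite (lactM hG).
Qed.

Let dyspan_gen i : dyspan (d (y i)).
Proof.
exists (fun j => (j == i)%:R) => [j|]; first by case: (j == i).
rewrite (bigD1 i) //= eqxx (lact1 hG) big1 ?addr0 // => j /negbTE ->.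
exact: (linear_zero (hl.1 _)).
Qed.

Let dyspan_sum (I : finType) (F : I -> Gam) :
  (forall i, dyspan (F i)) -> dyspan (\sum_i F i).
Proof. by move=> h; apply: submod_closed_sum. Qed.

Let dyspanZ k g : dyspan g -> dyspan (k *: g).
Proof.
move=> hg; rewrite -[_ *: _]addr0; apply: dyspanD => //.
by have [h _] := dyspan_submod; apply: set_mem.
Qed.

(** Induction on the acting element, for all [g] at once because a product acts in two steps. On a
    generator the relation [diff_y_ract_y] has its coefficients in [Y]. *)
Let dyspan_ract z : Y z -> forall g, dyspan g -> dyspan (g *R z).
Proof.
apply: (gen_subalg_ind (P := fun z => forall g, dyspan g -> dyspan (g *R z))) =>
    [g|k x x' _ _ hx hx' g hg|x x' _ _ hx hx' g hg|_ [j _ <-] g].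
- by rewrite (ract1 hG).
- by rewrite (hrt.2 g k); apply: dyspanD; [apply: hx | apply: hx'].
- by rewrite (ractM hG); apply/hx'/hx.
move=> [c Yc ->]; rewrite (linear_bigsum _ _ _ (hrt.1 _)); apply: dyspan_sum => i.
rewrite (lractA hG) diff_y_ract_y; apply: dyspan_lact => //; apply: dyspanZ.
by do 2!apply: dyspan_sum => ?; apply: dyspanZ; apply: dyspan_lact.
Qed.

Let dyspan_diff z : Y z -> dyspan (d z).
Proof.
apply: (gen_subalg_ind (P := fun z => dyspan (d z))) =>
    [|k x x' _ _ hx hx'|x x' Yx Yx' hx hx'|_ [j _ <-] //].
- by rewrite (diff1 hG); have [h _] := dyspan_submod; apply: set_mem.
- by rewrite hd; apply: dyspanD.
rewrite (diffM hG) -[_ *L _]scale1r; apply: dyspanD; first exact: dyspan_lact.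
exact: dyspan_ract.
Qed.

(** On generators Delta(y_i) = sum_k S(u^k_i) ⊗ y_k. *)
Lemma y_comul z : Y z -> tensor_of_sets setT Y (comul z).
Proof.
apply: gen_subalg_comul => _ [i _ <-].
rewrite comul_sw (sw_antipode_corep hu); last lin.
apply: submod_closed_sum => [|k _]; first exact: tensor_of_sets_submod.
exact: tensor_of_sets_pure.
Qed.

Lemma y_left_basis : left_basis Y (XdXX (Gam := Gam) Y) (fun i => d (y i)).
Proof.
have hX := XdXX_fodc hG (gen_subalg_closed (range y)).
split=> [i|g Gg|c _]; last exact: diff_y_free.
  by apply: (fodc_diff hX).
apply: (fodc_ind hG (P := dyspan) hX) Gg => [|k g' h|x x' Yx Yx'].
- by have [h _] := dyspan_submod; apply: set_mem.
- exact: dyspanD.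
- by apply: dyspan_lact => //; apply: dyspan_diff.
Qed.

End Calculus.
End LFunctionals.

Theorem proposition3
  (R : realType) (A : hopfAlgType R[i]) (r rbar : {scalar (A \ox A)%type})
  (hr : universal_rform r rbar)
  (n : nat) (u : 'M[A]_n.+1) (hu : matrix_corep u)
  (N : 'I_n.+1) (hN : N = ord_max)
  (lp : 'I_n.+1 -> 'I_n.+1 -> A -> R[i]) (hlp : lp = lplus r u)
  (lm : 'I_n.+1 -> 'I_n.+1 -> A -> R[i]) (hlm : lm = lminus rbar u)
  (ha_zero : forall (m : 'I_n.+1) (a : A), (m < N)%N ->
     lp N m a = 0 /\ lm m N a = 0)
  (ha_antipode : forall a : A,
     fantipode (lp N N) a = lm N N a /\ fantipode (lm N N) a = lp N N a)
  (gamma : 'I_n.+1 -> R[i]) (hgamma : forall i, gamma i != 0)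
  (hb : forall i j,
     antipode (antipode (u i j)) = (gamma i * (gamma j)^-1) *: u i j)
  (hc : forall i j, i != j -> lp i N (u N j) = 0)
  (hd_beta : beta r u != 0)
  (hd : forall i, i != N -> conv (lp N N) (lp i N) (u N i) = beta r u)
  (y : 'I_n.+1 -> A) (hy : y = fun i => antipode (u N i))
  (Y : set A) (hY : Y = gen_subalg (range y))
  (Gam : calculus_ops A)
  (hGam : left_covariant_fodc_on [set: A] [set: Gam])
  (hT : has_quantum_tangent_space Gam (lspan (range (Yfun r rbar u))))
  (GamY : set Gam) (hGamY : GamY = XdXX Y)
  (eta : Gam) (heta : eta = omega Gam (antipode_inv (u N N))) :
  (* second expression for eta_n *)
  eta = \sum_j lact (u j N) (diff Gam (antipode_inv (u N j))) /\
  (* (i) *)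
  [/\ left_covariant_fodc_on Y GamY,
      left_basis Y GamY (fun i => diff Gam (y i)),
      forall i j, ract (diff Gam (y i)) (y j) =
        lp N N (u N N) *: \sum_k \sum_m
          Rhat r u m k j i *: lact (y k) (diff Gam (y m))
    & forall z i, Y z -> ract (diff Gam (y i)) z =
        \sum_m lact
          (sw (fun z1 z' => sw (fun z2 z3 =>
             (gamma m / gamma i * rbar (z1 \ox u m i) * lm N N z3) *: z2)
             z') z)
          (diff Gam (y m))] /\
  (* (ii) *)
  (forall z, Y z ->
     diff Gam z = (beta r u)^-1 *: (ract eta z - lact z eta)).
Proof.
have lp0 (i j : 'I_n.+1) : i != j -> lplus r u i ord_max (u ord_max j) = 0.
  by move=> ij; rewrite -hlp -hN hc.
subst N lp lm y Y GamY eta.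
have lm0 (m : 'I_n.+1) a : (m < @ord_max n)%N -> lminus rbar u m ord_max a = 0.
  by move=> h; have [] := ha_zero m a h.
have lmS a : lminus rbar u ord_max ord_max (antipode a) = lplus r u ord_max ord_max a.
  by have [_] := ha_antipode a.
have lpS a : fantipode (lplus r u ord_max ord_max) a = lminus rbar u ord_max ord_max a.
  by have [] := ha_antipode a.
have [hG _] := hGam.
have [[Phi hPhi hfin] eT] := hT.
have Yf_tangent i : quantum_tangent_space Gam (Yfun r rbar u i).
  by rewrite eT; apply: lspan_gen; exists i.
have [|w omegaE] := tangent_dual_basis hG hPhi (X := Yfun r rbar u) hfin.
  by rewrite eT.
split; first exact: (omega_antipode_inv_diff hr hu lmS hgamma hb lp0 hd_beta hd lpS hG omegaE).
split; last first.
  move=> z _.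
  rewrite (omega_antipode_inv hr hu lmS hgamma hb lp0 hd_beta hd lpS hG omegaE).
  exact: (diff_inner hr hu lm0 lmS hgamma hb lp0 hd_beta hd lpS hG Yf_tangent omegaE).
split.
- apply: (XdXX_left_covariant hG hPhi); first exact: gen_subalg_closed.
  exact: y_comul.
- exact: (y_left_basis hr hu lm0 lmS hgamma hb lp0 hd_beta hd lpS hG hPhi Yf_tangent omegaE).
- exact: (diff_y_ract_y hr hu lm0 lmS hgamma hb lp0 hd_beta hd lpS hG omegaE).
move=> z i _.
rewrite (diff_y_ract hr hu lm0 lmS hgamma hb lp0 hd_beta hd lpS hG omegaE).
by apply: eq_bigr => m _; rewrite ract_coefE.
Qed.
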